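(* Let $G$ be a finitely generated group hyperbolic relative to a finite collection $\mathcal P=\{P_\lambda\}_{\lambda\in\Lambda}$, and $S$ a finite generating set. Then for all sufficiently large $n$, for every subgroup $H\le G$ the fixed-point set $(\Gamma_n^\blacktriangle)^H$ of $H$ in the $n$-Rips complex is either empty or contractible.
   Context: Let $\Gamma$ be the Cayley graph of $G$ with respect to $S$, $V=G$, $W$ the set of cosets $gP_\lambda$. Relative hyperbolicity means the coned-off Cayley graph (vertex set $V\cup W$, edges of $\Gamma$ plus an edge $(v,w)$ whenever $v\in w$) is fine and $\delta$-hyperbolic. Extend $|\cdot,\cdot|_S$ to $V\cup W$ via distances in $\Gamma$ between the corresponding elements/cosets. $\Gamma_n$ has vertex set $V\cup W$ and an edge between $u\ne u'$ whenever $|u,u'|_S\le n$; $\Gamma_n^\blacktriangle$ is obtained by spanning simplices on all cliques of $\Gamma_n$, with $G$ acting by left multiplication. *)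

(* Defs.v *)
From HB Require Import structures.
From mathcomp Require Import all_boot all_order all_algebra.
From mathcomp Require Import all_classical all_reals all_analysis.
From Stdlib Require Import List.

Set Implicit Arguments.
Unset Strict Implicit.
Unset Printing Implicit Defensive.

Import Order.TTheory GRing.Theory Num.Theory.
Import numFieldNormedType.Exports.
Local Open Scope classical_set_scope.

Section Graphs.
Variable V : Type.
Variable adj : V -> V -> Prop.

Fixpoint walk (u : V) (p : list V) : Prop :=
  match p with
  | [::] => True
  | x :: p' => adj u x /\ walk x p'
  end.

Definition gconnected : Prop :=
  forall u v, exists p, walk u p /\ List.last p u = v.

Definition within (u v : V) (n : nat) : Prop :=
  exists p, walk u p /\ List.last p u = v /\ (List.length p <= n)%N.

Definition geodesic (u : V) (p : list V) : Prop :=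
  walk u p /\ forall q, walk u q -> List.last q u = List.last p u ->
    (List.length p <= List.length q)%N.

Definition thin_triangles (delta : nat) : Prop :=
  forall (x : V) (p q r : list V),
    geodesic x p -> geodesic (List.last p x) q ->
    geodesic (List.last q (List.last p x)) r ->
    List.last r (List.last q (List.last p x)) = x ->
    forall w, List.In w (x :: p) ->
      exists w', (List.In w' (List.last p x :: q) \/
                  List.In w' (List.last q (List.last p x) :: r)) /\
                 within w w' delta.

Definition ghyperbolic : Prop :=
  gconnected /\ exists delta : nat, thin_triangles delta.

Definition circuit_through (u v : V) (c : list V) : Prop :=
  exists rest, c = u :: v :: rest /\ List.NoDup c /\ walk v rest /\
    adj (List.last rest v) u /\ (3 <= List.length c)%N.

Definition fine : Prop :=
  forall u v, adj u v -> forall k : nat,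
    exists L : list (list V), forall c, circuit_through u v c ->
      List.length c = k -> List.In c L.

Definition clique (l : list V) : Prop :=
  forall u v, List.In u l -> List.In v l -> u <> v -> adj u v.

End Graphs.

(* Geometric realization of the flag (clique) complex of a graph,      *)
(* with the weak (coherent) topology.                                  *)
Section Realization.
Variable R : realType.
Variable V : Type.
Variable adj : V -> V -> Prop.

Definition is_pt (a : V -> R) : Prop :=
  (forall v, 0 <= a v)%R /\
  exists l : list V, List.NoDup l /\ clique adj l /\
    (forall v, a v <> 0%R -> List.In v l) /\ (\sum_(v <- l) a v = 1)%R.

Definition realization := {a : V -> R | is_pt a}.
HB.instance Definition _ := gen_eqMixin realization.
HB.instance Definition _ := gen_choiceMixin realization.



Definition closed_simplex (l : list V) : set realization :=
  [set p | forall v, proj1_sig p v <> 0%R -> List.In v l].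

Definition coords (l : list V) (p : realization) : 'rV[R]_(size l) :=
  \row_(i < size l) proj1_sig p (tnth (in_tuple l) i).

Definition weak_open (U : set realization) : Prop :=
  forall l : list V, List.NoDup l -> clique adj l ->
    exists O : set 'rV[R]_(size l), open O /\
      U `&` closed_simplex l = coords l @^-1` O `&` closed_simplex l.

Lemma weak_openT : weak_open setT.
Proof. by move=> l _ _; exists setT; split; [exact: openT|]. Qed.

Lemma weak_openI : setI_closed weak_open.
Proof.
move=> A B oA oB l nd cl.
have [OA [oOA eA]] := oA l nd cl.
have [OB [oOB eB]] := oB l nd cl.
exists (OA `&` OB); split; first exact: openI.
apply/seteqP; split=> x /=.
- move=> [[Ax Bx] cx].
  have : (A `&` closed_simplex l) x by [].
  have : (B `&` closed_simplex l) x by [].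
  by rewrite eA eB => -[OBx _] [OAx _].
- move=> [[OAx OBx] cx].
  have : (coords l @^-1` OA `&` closed_simplex l) x by [].
  have : (coords l @^-1` OB `&` closed_simplex l) x by [].
  by rewrite -eA -eB => -[Bx _] [Ax _].
Qed.

Lemma weak_open_bigU (I : Type) (f : I -> set realization) :
  (forall i, weak_open (f i)) -> weak_open (\bigcup_i f i).
Proof.
move=> hf l nd cl.
have h i : {O : set 'rV[R]_(size l) | open O /\
    f i `&` closed_simplex l = coords l @^-1` O `&` closed_simplex l}.
  exact: cid (hf i l nd cl).
exists (\bigcup_i proj1_sig (h i)); split.
  by apply: bigcup_open => i _; case: (proj2_sig (h i)).
rewrite setI_bigcupl preimage_bigcup setI_bigcupl.
by apply: eq_bigcupr => i _; case: (proj2_sig (h i)).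
Qed.

HB.instance Definition _ := isOpenTopological.Build realization
  weak_openT weak_openI weak_open_bigU.

End Realization.

Definition contractible (R : realType) (T : topologicalType) (A : set T) : Prop :=
  exists x0 : T, A x0 /\
  exists Hm : T * R -> T,
    {within A `*` `[0%R, 1%R], continuous Hm} /\
    (forall x t, A x -> `[0%R, 1%R] t -> A (Hm (x, t))) /\
    (forall x, A x -> Hm (x, 0%R) = x /\ Hm (x, 1%R) = x0).

Section RelHyp.
Local Open Scope group_scope.
Variable G : groupType.
Variable Lam : Type.
Variable P : Lam -> set G.
Variable S : list G.

Definition is_subgroup (H : set G) : Prop :=
  H 1 /\ (forall x y, H x -> H y -> H (x * y)) /\ (forall x, H x -> H x^-1).

Definition generates : Prop :=
  forall g : G, exists w : list G,
    (forall x, List.In x w -> List.In x S \/ List.In x^-1 S) /\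
    g = foldr (fun x y => x * y) 1 w.

Definition lcoset (g : G) (A : set G) : set G := [set g * a | a in A].

Definition coset := {c : Lam * set G | exists g, c.2 = lcoset g (P c.1)}.

Definition vertex := (G + coset)%type.

Definition cayley (a b : G) : Prop :=
  a <> b /\ exists s, List.In s S /\ (b = a * s \/ a = b * s).

Definition elts (u : vertex) : set G :=
  match u with inl g => [set g] | inr c => (proj1_sig c).2 end.

Definition coned_off (u v : vertex) : Prop :=
  match u, v with
  | inl a, inl b => cayley a b
  | inl a, inr c => (proj1_sig c).2 a
  | inr c, inl a => (proj1_sig c).2 a
  | inr _, inr _ => False
  end.

Definition rel_hyperbolic : Prop :=
  (forall lam, is_subgroup (P lam)) /\ generates /\
  fine coned_off /\ ghyperbolic coned_off.

Definition sdist_le (u u' : vertex) (n : nat) : Prop :=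
  exists a b, elts u a /\ elts u' b /\ within cayley a b n.

Definition rips (n : nat) (u u' : vertex) : Prop :=
  u <> u' /\ sdist_le u u' n.

Lemma lcoset_trans (h : G) (c : coset) :
  exists g, lcoset h (proj1_sig c).2 = lcoset g (P (proj1_sig c).1).
Proof.
case: c => [[lam A] [g /= ->]]; exists (h * g).
rewrite /lcoset; apply/seteqP; split=> y /=.
- by move=> [_ [p Pp <-] <-]; exists p => //; rewrite mulgA.
- by move=> [p Pp <-]; exists (g * p); [exists p|rewrite mulgA].
Qed.

Definition act_coset (h : G) (c : coset) : coset :=
  exist _ ((proj1_sig c).1, lcoset h (proj1_sig c).2) (lcoset_trans h c).

Definition act (h : G) (u : vertex) : vertex :=
  match u with inl g => inl (h * g) | inr c => inr (act_coset h c) end.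

Definition fixed_set (R : realType) (n : nat) (H : set G) :
  set (realization R (rips n)) :=
  [set p | forall h, H h -> forall v, proj1_sig p (act h v) = proj1_sig p v].

End RelHyp.

(* Main.v *)
Require Import Defs.
From HB Require Import structures.
From mathcomp Require Import all_boot all_order all_algebra.
From mathcomp Require Import all_classical all_reals all_analysis.
From mathcomp Require Import Rstruct Rstruct_topology.
From mathcomp Require Import zify lra.

(** Fix a point [p] of the Rips complex fixed by [H], with support the clique [B], and let the level
    of a vertex [u] be its largest [S]-distance to [B].  For large [n] every vertex [u] of level
    greater than [n] is dominated: some [z] of smaller level is [n]-close to every vertex that is
    [n]-close to [u] and not of larger level.  Averaging [z] over a finite coset of the
    [H]-stabiliser of [u], all vertices are pushed [H]-equivariantly down to level at most [n], the
    higher levels moving first; what remains is a cone with apex [p].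

    Domination comes from coned-off geometry.  Fineness bounds the angle at a coset by the length
    of a detour around it, and with hyperbolicity this makes geodesic triangles of the coned-off
    graph thin for the [S]-distance on their group elements.  Hence a group element on a coned-off
    geodesic lies logarithmically close to any path with the same ends, and boundedly close if the
    path is an [S]-geodesic: apply the logarithmic bound to the piece of the [S]-geodesic near the
    element.  So [S]-distances are additive along coned-off geodesics up to a constant.  For [z]
    take the group element, or the coset crossed, at [S]-distance about [n / 2] from [u] on a
    coned-off geodesic from [u] to the farthest vertex of [B]. *)

Set Implicit Arguments.
Unset Strict Implicit.
Unset Printing Implicit Defensive.

Import Order.TTheory GRing.Theory Num.Theory.
Import numFieldNormedType.Exports.

(** * Distances and geodesics in graphs *)

(** Total, with value 0 on an empty predicate, so that distances are defined without a proof of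
    connectedness. *)
Definition least (Q : nat -> Prop) : nat :=
  xget 0 [set n | Q n /\ forall m, Q m -> n <= m]%classic.

Lemma leastP (Q : nat -> Prop) : (exists n, Q n) ->
  Q (least Q) /\ forall m, Q m -> least Q <= m.
Proof.
move=> [n Qn].
have ex : exists n, `[< Q n >] by exists n; apply/asboolP.
rewrite /least; case: xgetP => [//|/(_ (ex_minn ex)) []] /=.
case: ex_minnP => m /asboolP Qm min; split=> // k Qk.
by apply: min; apply/asboolP.
Qed.

Notation reach := Defs.within.

Section Reach.
Variables (V : Type) (adj : V -> V -> Prop).

Lemma reach_refl u n : reach adj u u n.
Proof. by exists [::]. Qed.

Lemma reach_cons u x v n : adj u x -> reach adj x v n -> reach adj u v n.+1.
Proof.
move=> ux [p [wp [lp sp]]]; exists (x :: p); split=> //=; split=> //.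
by case: p wp lp sp => //= y p _ <- _; elim: p y => //= z p IH y; apply: IH.
Qed.

Lemma reachS u v n : reach adj u v n.+1 ->
  u = v \/ exists2 x, adj u x & reach adj x v n.
Proof.
move=> [[|x p] [wp [lp sp]]]; [by left | right].
case: wp => ux wp; exists x => //; exists p; split=> //; split=> //.
rewrite -lp; case: {lp sp} p wp => //= y p _.
by elim: p y => //= z p IH y; apply: IH.
Qed.

Lemma reach0 u v : reach adj u v 0 -> u = v.
Proof. by move=> [[|x p] [_ [lp]]]. Qed.

Lemma reach_le u v m n : m <= n -> reach adj u v m -> reach adj u v n.
Proof. by move=> mn [p [wp [lp sp]]]; exists p; do 2!split => //; apply: leq_trans sp mn. Qed.

Lemma reach_trans v u w m n :
  reach adj u v m -> reach adj v w n -> reach adj u w (m + n).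
Proof.
elim: m u => [|m IH] u; first by move/reach0 ->.
move=> /reachS [->|[x ux xv]] vw; first by apply: reach_le vw; lia.
by rewrite addSn; apply: reach_cons ux _; apply: IH.
Qed.

Lemma reach_adj u v : adj u v -> reach adj u v 1.
Proof. by move=> uv; apply: reach_cons uv (reach_refl _ _). Qed.

Hypothesis adjC : forall u v, adj u v -> adj v u.

Lemma reach_sym u v n : reach adj u v n -> reach adj v u n.
Proof.
elim: n u => [|n IH] u; first by move/reach0 ->; apply: reach_refl.
move=> /reachS [->|[x ux xv]]; first exact: reach_refl.
by rewrite -addn1; apply: reach_trans (IH _ xv) _; apply/reach_adj/adjC.
Qed.

End Reach.

Lemma reach_map (V V' : Type) (adj : V -> V -> Prop) (adj' : V' -> V' -> Prop)
    (f : V -> V') u v n :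
  (forall x y, adj x y -> adj' (f x) (f y)) ->
  reach adj u v n -> reach adj' (f u) (f v) n.
Proof.
move=> fP; elim: n u => [|n IH] u; first by move=> h; rewrite (reach0 h); apply: reach_refl.
move=> h; case: (reachS h) => [->|[x ux xv]]; first exact: reach_refl.
by apply: reach_cons (fP _ _ ux) (IH _ xv).
Qed.

Section Dist.
Variables (V : Type) (adj : V -> V -> Prop).
Hypothesis adjC : forall u v, adj u v -> adj v u.
Hypothesis conn : forall u v, exists n, reach adj u v n.

Definition gdist u v := least (reach adj u v).
Local Notation d := gdist.

Lemma gdistP u v : reach adj u v (d u v).
Proof. by case: (leastP (conn u v)). Qed.

Lemma gdist_le u v n : reach adj u v n -> d u v <= n.
Proof. by case: (leastP (conn u v)) => _; apply. Qed.

Lemma gdistC u v : d u v = d v u.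
Proof.
apply/eqP; rewrite eqn_leq; apply/andP; split;
  by apply: gdist_le; apply: reach_sym => //; apply: gdistP.
Qed.

Lemma gdist_tri v u w : d u w <= d u v + d v w.
Proof. by apply: gdist_le; apply: reach_trans (gdistP _ _) (gdistP _ _). Qed.

Lemma gdistxx u : d u u = 0.
Proof. by apply/eqP; rewrite -leqn0; apply/gdist_le/reach_refl. Qed.

Lemma gdist0 u v : d u v = 0 -> u = v.
Proof. by move=> d0; apply: (@reach0 _ adj); rewrite -d0; apply: gdistP. Qed.

Lemma gdist_adj u v : adj u v -> d u v <= 1.
Proof. by move=> uv; apply/gdist_le/reach_adj. Qed.

(* Only the values of [f] at indices at most [d a b] matter. *)
Definition geo (a b : V) (f : nat -> V) :=
  [/\ f 0 = a, f (d a b) = b & forall i, i < d a b -> adj (f i) (f i.+1)].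

(** Walks become functions of an index, so that subwalks and reversals are mere changes of index. *)
Lemma reach_fun u v n : reach adj u v n -> exists m (f : nat -> V),
  [/\ m <= n, f 0 = u, f m = v & forall i, i < m -> adj (f i) (f i.+1)].
Proof.
elim: n u => [|n IH] u; first by move=> h; rewrite (reach0 h); exists 0, (fun=> v).
move=> h; case: (reachS h) => [->|[x ux xv]]; first by exists 0, (fun=> v).
have [m [f [mn f0 fm fa]]] := IH _ xv.
exists m.+1, (fun i => if i is j.+1 then f j else u); split=> //.
by case=> [|i] //=; [rewrite f0 | apply: fa].
Qed.

Lemma fun_reach (f : nat -> V) i j : i <= j ->
  (forall k, i <= k < j -> adj (f k) (f k.+1)) -> reach adj (f i) (f j) (j - i).
Proof.
move=> ij; have -> : j = i + (j - i) by lia.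
rewrite addKn; elim: (j - i) => [|m IH] fa; first by rewrite addn0; apply: reach_refl.
rewrite -[X in reach _ _ _ X]addn1; apply: reach_trans (IH _) _.
  by move=> k ?; apply: fa; lia.
by apply: reach_adj; rewrite addnS; apply: fa; lia.
Qed.

Lemma geo_ex a b : exists f, geo a b f.
Proof.
have [m [f [mn f0 fm fa]]] := reach_fun (gdistP a b).
suff em : d a b = m by exists f; split; rewrite ?em.
apply/eqP; rewrite eqn_leq mn andbT; apply: gdist_le.
by have := @fun_reach f 0 m isT; rewrite subn0 f0 fm; apply=> k; apply: fa.
Qed.

(** A shortcut between two points of a geodesic would, by the triangle inequality through the outer
    pieces, shorten the whole. *)
Lemma geo_dist a b f i j : geo a b f -> i <= j -> j <= d a b -> d (f i) (f j) = j - i.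
Proof.
move=> [f0 fm fa] ij jm.
have le k l : k <= l -> l <= d a b -> d (f k) (f l) <= l - k.
  by move=> kl lm; apply/gdist_le/fun_reach => // k' ?; apply: fa; lia.
have := le 0 i isT (leq_trans ij jm); have := le i j ij jm.
have := le j (d a b) jm (leqnn _); rewrite f0 fm.
by have := gdist_tri (f i) a b; have := gdist_tri (f j) (f i) b; lia.
Qed.

Lemma geo_inj a b f i j : geo a b f -> i <= d a b -> j <= d a b -> f i = f j -> i = j.
Proof.
move=> gf im jm e; wlog ij : i j im jm e / i <= j.
  by move=> w; case: (leqP i j) => h; [|symmetry]; apply: w => //; apply: ltnW.
by have := geo_dist gf ij jm; rewrite e gdistxx; lia.
Qed.

Lemma geo_rev a b f : geo a b f -> geo b a (fun i => f (d a b - i)).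
Proof.
move=> [f0 fm fa]; split; rewrite ?subn0 ?(gdistC b a) ?subnn // => i im.
have e : d a b - i = (d a b - i.+1).+1 by lia.
by apply: adjC; rewrite e; apply: fa; lia.
Qed.

Lemma geo_sub a b f i j : geo a b f -> i <= j -> j <= d a b ->
  geo (f i) (f j) (fun k => f (i + k)).
Proof.
move=> gf ij jm; rewrite /geo (geo_dist gf) //; split; rewrite ?addn0 ?subnKC // => k ?.
by rewrite addnS; case: gf => _ _; apply; lia.
Qed.

Lemma geo_dist0 a b f i : geo a b f -> i <= d a b -> d a (f i) = i.
Proof. by move=> gf im; have := geo_dist gf (leq0n i) im; case: gf => -> _ _; lia. Qed.

(** All three sides are oriented away from [a] or from [b], and only the first side is treated; the
    other cases come by reversing and relabelling sides. *)
Definition thin delta := forall a b c A B C, geo a b A -> geo b c B -> geo a c C ->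
  forall i, i <= d a b ->
  (exists2 j, j <= d b c & d (A i) (B j) <= delta) \/
  (exists2 j, j <= d a c & d (A i) (C j) <= delta).

Lemma last_map_iota (f : nat -> V) i n x :
  List.last [seq f k | k <- iota i n.+1] x = f (i + n).
Proof.
elim: n i => [|n IH] i; first by rewrite addn0.
by rewrite addnS -addSn -IH.
Qed.

Lemma last_seg (f : nat -> V) n : List.last [seq f k | k <- iota 1 n] (f 0) = f n.
Proof. by case: n => // n; rewrite last_map_iota. Qed.

Lemma walk_seg (f : nat -> V) i n : (forall k, i <= k < i + n -> adj (f k) (f k.+1)) ->
  walk adj (f i) [seq f k | k <- iota i.+1 n].
Proof.
elim: n i => //= n IH i fa; split; first by apply: fa; lia.
by apply: IH => k ?; apply: fa; lia.
Qed.

Lemma in_seg (f : nat -> V) i n x : List.In x [seq f k | k <- iota i n] ->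
  exists2 k, i <= k < i + n & x = f k.
Proof.
elim: n i => //= n IH i [<-|/IH [k kP ->]]; first by exists i => //; lia.
by exists k => //; lia.
Qed.

Lemma seg_in (f : nat -> V) i n k : i <= k < i + n ->
  List.In (f k) [seq f k | k <- iota i n].
Proof.
elim: n i => [|n IH] i; first by lia.
by move=> ?; case: (eqVneq i k) => [->|ne] /=; [left | right; apply: IH; lia].
Qed.

Lemma in_seg0 (f : nat -> V) n x : List.In x (f 0 :: [seq f k | k <- iota 1 n]) ->
  exists2 k, k <= n & x = f k.
Proof. by case=> [<-|/in_seg [k kP ->]]; [exists 0 | exists k => //; lia]. Qed.

Lemma geo_geodesic a b f : geo a b f ->
  geodesic adj a [seq f k | k <- iota 1 (d a b)].
Proof.
move=> gf; case: (gf) => f0 fm fa; split.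
  by have := @walk_seg f 0 (d a b); rewrite f0; apply=> k ?; apply: fa; lia.
have := last_seg f (d a b); rewrite f0 fm => -> q wq lq.
have -> : List.length [seq f k | k <- iota 1 (d a b)] = d a b.
  by rewrite -[List.length _]/(size _) size_map size_iota.
by apply: gdist_le; exists q.
Qed.

Lemma thin_triangles_thin delta : thin_triangles adj delta -> thin delta.
Proof.
move=> tt a b c A B C gA gB gC i im.
have gC' := geo_rev gC.
have lst x y f : geo x y f -> List.last [seq f k | k <- iota 1 (d x y)] x = y.
  by move=> [f0 fm _]; have := last_seg f (d x y); rewrite f0 fm.
have := tt a _ _ _ (geo_geodesic gA); rewrite (lst _ _ _ gA).
move=> /(_ _ _ (geo_geodesic gB)); rewrite (lst _ _ _ gB).
move=> /(_ _ (geo_geodesic gC')); rewrite (lst _ _ _ gC') => /(_ erefl (A i)) [].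
  by case: i im => [|i] im; [left; case: gA | right; apply: seg_in; lia].
move=> x [xin /gdist_le dx]; case: xin.
  have := @in_seg0 B (d b c) x; case: (gB) => -> _ _ h /h [j jm xe].
  by left; exists j => //; rewrite -xe.
have := @in_seg0 (fun i => C (d a c - i)) (d c a) x.
rewrite [X in X :: _](_ : _ = c); last by case: gC'.
move=> h /h [j jm xe].
by right; exists (d a c - j); [lia | rewrite -xe].
Qed.

End Dist.

(** * Coned-off geometry *)

Section Avoid.
Variables (V : Type) (adj : V -> V -> Prop).

Definition avoid (w u v : V) := [/\ adj u v, u <> w & v <> w].

(** Loop erasure: restart the walk at its visit to [u]. Simple walks are wanted because the circuits
    counted by fineness repeat no vertex. *)
Lemma walk_cut u x p : walk adj x p -> List.NoDup (x :: p) -> List.In u (x :: p) ->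
  exists p', [/\ walk adj u p', List.last p' u = List.last p x,
                 List.NoDup (u :: p') & List.length p' <= List.length p].
Proof.
elim: p x => [|y p IH] x wp nd uin.
  by case: uin => // <-; exists [::].
case: uin => [<-|uin]; first by exists (y :: p).
case: wp => xy wp; have nd' : List.NoDup (y :: p) by inversion nd.
have [p' [wp' lp' nd2 sp]] := IH y wp nd' uin.
exists p'; split=> //; last by rewrite /=; lia.
rewrite lp' /=; case: (p) => // z q; elim: q z => //= t q IHq z; exact: IHq.
Qed.

Lemma reach_nodup u v n : reach adj u v n -> exists p,
  [/\ walk adj u p, List.last p u = v, List.NoDup (u :: p) & List.length p <= n].
Proof.
elim: n u => [|n IH] u h.
  by rewrite (reach0 h); exists [::]; split=> //; constructor=> //; constructor.
case: (reachS h) => [->|[x ux xv]].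
  by exists [::]; split=> //; constructor=> //; constructor.
have [p [wp lp nd sp]] := IH _ xv.
case: (pselect (List.In u (x :: p))) => [uin|unin].
  have [p' [wp' lp' nd' sp']] := walk_cut wp nd uin.
  by exists p'; split=> //; [rewrite lp' | lia].
exists (x :: p); split=> //; last by constructor.
rewrite -lp /=; case: (p) => // z q; elim: q z => //= t q IHq z; exact: IHq.
Qed.

Lemma walk_avoid w u p : walk (avoid w) u p -> walk adj u p /\ ~ List.In w p.
Proof.
elim: p u => [|x p IH] u /=; first by split.
move=> [[ux _ xw] /IH [wp nin]]; split=> //.
by case.
Qed.

Lemma avoidC w u v : (forall x y, adj x y -> adj y x) -> avoid w u v -> avoid w v u.
Proof. by move=> adjC [uv uw vw]; split=> //; apply: adjC. Qed.

Lemma last_in (p : list V) u : p <> [::] -> List.In (List.last p u) p.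
Proof.
elim: p => // x [|y q] IH _; first by left.
by right; apply: IH.
Qed.

End Avoid.

Lemma sq_le_exp2 k : 4 <= k -> k * k <= 2 ^ k.
Proof.
elim: k => // k IH; rewrite leq_eqVlt => /orP [/eqP <- //|k4].
by have := IH k4; rewrite expnS; nia.
Qed.

(** Drives the bootstrap for quasi-geodesics: a large bound [h] is strictly improved by the
    logarithm of a window whose length is linear in [h]. *)
Lemma log_lt_linear D : exists K, forall h, K < h ->
  exists2 k, 2 * (2 * h + 2 * D + 1) <= 2 ^ k & 2 * D + D * k < h.
Proof.
(* The threshold makes the quotient [k] below at least [20 * D + 10], so that [k * k] exceeds the
   left side, which is linear in [k]. *)
exists (D.+1 * (20 * D + 10) + 2 * D + 1) => h Kh.
have hE := divn_eq (h - (2 * D + 1)) D.+1.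
have hm : (h - (2 * D + 1)) %% D.+1 < D.+1 by rewrite ltn_mod.
set k := _ %/ _ in hE; set r := _ %% _ in hE hm.
have k0 : 20 * D + 10 <= k by nia.
exists k; last nia.
by apply: leq_trans (sq_le_exp2 _); [nia | lia].
Qed.

(** * The group action on vertices and the [S]-distance *)

Section ConedOff.
Local Open Scope group_scope.
Local Open Scope nat_scope.
Variables (G : groupType) (Lam : finType) (P : Lam -> set G) (S : list G).
Hypothesis subP : forall lam, is_subgroup (P lam).
Hypothesis gen : generates S.
Local Notation X := (vertex P).
Local Notation adj := (@coned_off G Lam P S).
Local Notation cay := (cayley S).

Lemma cayleyC a b : cay a b -> cay b a.
Proof.
move=> [ne [s [sS e]]]; split; first exact: nesym.
by exists s; split=> //; case: e; [right | left].
Qed.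

Lemma coned_offC (u v : X) : adj u v -> adj v u.
Proof. by case: u v => [a|c] [b|c'] //=; apply: cayleyC. Qed.

Lemma coset_eq (c c' : coset P) : proj1_sig c = proj1_sig c' -> c = c'.
Proof. by case: c c' => [x p] [y q] /= e; subst y; congr exist; apply: Prop_irrelevance. Qed.

Lemma lcosetM (g h : G) (A : set G) : lcoset (g * h)%g A = lcoset g (lcoset h A).
Proof.
apply/seteqP; split=> y /=.
- by move=> [a Aa <-]; exists (h * a)%g; [exists a | rewrite mulgA].
- by move=> [_ [a Aa <-] <-]; exists a => //; rewrite mulgA.
Qed.

Lemma lcoset1 (A : set G) : lcoset 1%g A = A.
Proof.
apply/seteqP; split=> y /=; first by move=> [a Aa <-]; rewrite mul1g.
by move=> Ay; exists y => //; rewrite mul1g.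
Qed.

Lemma actM g h (u : X) : act (g * h)%g u = act g (act h u).
Proof.
case: u => [a|c] /=; first by rewrite mulgA.
by congr inr; apply: coset_eq => /=; rewrite lcosetM.
Qed.

Lemma act1 (u : X) : act 1%g u = u.
Proof.
case: u => [a|c] /=; first by rewrite mul1g.
by congr inr; apply: coset_eq => /=; rewrite lcoset1; case: c => -[].
Qed.

Lemma actK g : cancel (act g) (act g^-1%g : X -> X).
Proof. by move=> u; rewrite -actM mulVg act1. Qed.

Lemma actVK g : cancel (act g^-1%g) (act g : X -> X).
Proof. by move=> u; rewrite -actM mulgV act1. Qed.

Lemma act_inj g : injective (act g : X -> X).
Proof. exact: can_inj (actK g). Qed.

Lemma cayley_act g a b : cay a b -> cay (g * a)%g (g * b)%g.
Proof.
move=> [ne [s [sS e]]]; split; first by move/mulgI.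
by exists s; split=> //; case: e => ->; rewrite mulgA; [left | right].
Qed.

Lemma elts_act g (u : X) a : elts u a -> elts (act g u) (g * a)%g.
Proof. by case: u => [b|c] /= => [->//|ca]; exists a. Qed.

Lemma coned_off_act g (u v : X) : adj u v -> adj (act g u) (act g v).
Proof.
by case: u v => [a|c] [b|c'] //=; [apply: cayley_act | move=> h; exists a | move=> h; exists b].
Qed.

Lemma elts_ex (u : X) : exists a, elts u a.
Proof.
case: u => [a|[[lam A] [g /= e]]] /=; first by exists a.
by exists g; rewrite e; exists 1%g; [case: (subP lam) | rewrite mulg1].
Qed.

Lemma cayley_conn a b : exists n, reach cay a b n.
Proof.
have [w [wS e]] := gen (a^-1 * b)%g.
have -> : b = (a * (a^-1 * b))%g by rewrite mulgA mulgV mul1g.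
rewrite e; exists (size w) => {e}.
elim: w a wS => [|x w IH] a wS /=; first by rewrite mulg1; apply: reach_refl.
rewrite mulgA; have /IH h y : List.In y w -> _ := fun yw => wS y (or_intror yw).
(* A letter equal to 1 gives no edge of the Cayley graph and is skipped. *)
case: (pselect (x = 1%g)) => [->|x1]; first by rewrite mulg1; apply: reach_le (h a).
apply: reach_cons (h _); split.
  by move=> e; apply: x1; apply: (@mulgI _ a); rewrite mulg1.
case: (wS x (or_introl erefl)) => xS; first by exists x; split=> //; left.
by exists x^-1%g; split=> //; right; rewrite mulgK.
Qed.

Definition sdist (u v : X) := least (sdist_le S u v).

Lemma sdist_ex (u v : X) : exists n, sdist_le S u v n.
Proof.
have [a ua] := elts_ex u; have [b vb] := elts_ex v.
by have [n ab] := cayley_conn a b; exists n, a, b.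
Qed.

Lemma sdistP (u v : X) : exists a b, [/\ elts u a, elts v b & reach cay a b (sdist u v)].
Proof. by have [[a [b [ua [vb ab]]]] _] := leastP (sdist_ex u v); exists a, b. Qed.

Lemma sdist_le_min (u v : X) a b n : elts u a -> elts v b -> reach cay a b n -> sdist u v <= n.
Proof. by move=> ua vb ab; have [_] := leastP (sdist_ex u v); apply; exists a, b. Qed.

Lemma sdist_leP (u v : X) n : sdist_le S u v n <-> sdist u v <= n.
Proof.
split=> [[a [b [ua [vb ab]]]]|le]; first exact: sdist_le_min ua vb ab.
by have [a [b [ua vb ab]]] := sdistP u v; exists a, b; do 2!split => //; apply: reach_le ab.
Qed.

Lemma sdistC (u v : X) : sdist u v = sdist v u.
Proof.
have le x y : sdist x y <= sdist y x.
  have [a [b [ya xb ab]]] := sdistP y x.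
  by apply: sdist_le_min xb ya _; apply: reach_sym ab; apply: cayleyC.
by apply/eqP; rewrite eqn_leq !le.
Qed.

(** The middle vertex must be a group element: [sdist] is a distance between subsets, and through a
    coset the points of arrival and departure may be far apart. *)
Lemma sdist_tri g (u v : X) : sdist u v <= sdist u (inl g) + sdist (inl g) v.
Proof.
have [a [g' [ua /= -> ag]]] := sdistP u (inl g).
have [g'' [b [/= -> vb gb]]] := sdistP (inl g) v.
by apply: sdist_le_min ua vb _; apply: reach_trans ag gb.
Qed.

Lemma sdist_elts (u v : X) g : elts v g -> sdist u v <= sdist u (inl g).
Proof.
move=> vg; have [a [g' [ua /= -> ag]]] := sdistP u (inl g).
exact: sdist_le_min ua vg ag.
Qed.

Lemma sdistxx (u : X) : sdist u u = 0.
Proof.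
have [a ua] := elts_ex u.
by apply/eqP; rewrite -leqn0; apply: (sdist_le_min ua ua (reach_refl _ _ _)).
Qed.

Lemma sdist_elt0 (u : X) g : elts u g -> sdist u (inl g) = 0.
Proof. by move=> ug; apply/eqP; rewrite -leqn0 sdistC -(sdistxx (inl g)) sdist_elts. Qed.

Lemma sdist_act g (u v : X) : sdist (act g u) (act g v) = sdist u v.
Proof.
have le h x y : sdist (act h x) (act h y) <= sdist x y.
  have [a [b [xa yb ab]]] := sdistP x y.
  apply: sdist_le_min (elts_act h xa) (elts_act h yb) _.
  by apply: reach_map ab => ? ?; apply: cayley_act.
apply/eqP; rewrite eqn_leq le /=.
by have := le g^-1%g (act g u) (act g v); rewrite !actK.
Qed.

Lemma sdist_cay a b : cay a b -> sdist (inl a) (inl b) <= 1.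
Proof. by move=> ab; apply: sdist_le_min (reach_adj ab). Qed.

(* The only use of fineness: angles at cosets are bounded by the length
   of a detour avoiding the coset, uniformly by cofiniteness of the action. *)
Hypothesis finX : Defs.fine adj.

(** * Angles at cosets *)

Lemma base_ex lam : exists g, P lam = lcoset g (P lam).
Proof. by exists 1%g; rewrite lcoset1. Qed.

Definition base lam : coset P := exist _ (lam, P lam) (base_ex lam).

(** Cofiniteness of the action: each orbit of cosets contains the subgroup [P lam] itself for its
    index [lam]. *)
Lemma coset_base (c : coset P) a : elts (inr c) a ->
  act a^-1%g (inr c) = inr (base (proj1_sig c).1).
Proof.
move=> ca; congr inr; apply: coset_eq.
case: c ca => -[lam A] [g /= e]; rewrite {}e => -[p Pp <-]; congr pair.
rewrite -lcosetM invgM -mulgA mulVg mulg1.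
have [_ [PM PV]] := subP lam.
apply/seteqP; split=> y /=; first by move=> [x Px <-]; apply: PM => //; apply: PV.
by move=> Py; exists (p * y)%g; [apply: PM | rewrite mulgA mulVg mul1g].
Qed.

Lemma list_sdist_bound (l : list X) : exists D, forall g,
  List.In (inl g : X) l -> sdist (inl 1%g) (inl g) <= D.
Proof.
elim: l => [|u l [D HD]]; first by exists 0.
exists (maxn (sdist (inl 1%g) u) D) => g /= [->|/HD h]; first exact: leq_maxl.
exact: leq_trans h (leq_maxr _ _).
Qed.

Lemma fine_le u v n : adj u v -> exists L : list (list X), forall c,
  circuit_through adj u v c -> List.length c <= n -> List.In c L.
Proof.
move=> uv; elim: n => [|n [L HL]].
  by exists [::] => c [rest [-> _]].
have [L' HL'] := finX uv n.+1; exists (L ++ L') => c cc sc.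
apply/List.in_or_app; case: (ltnP n (List.length c)) => h; last by left; apply: HL.
by right; apply: HL' => //; lia.
Qed.

(** A simple detour from 1 to [y], closed up through the coset, is a circuit through the edge from
    the coset to 1. Fineness leaves finitely many circuits of bounded length, hence finitely many
    [y]. *)
Lemma base_angle lam k : exists D, forall y, P lam y ->
  reach (avoid adj (inr (base lam))) (inl 1%g) (inl y) k -> sdist (inl 1%g) (inl y) <= D.
Proof.
have e1 : adj (inr (base lam)) (inl 1%g) by case: (subP lam).
have [L HL] := fine_le k.+2 e1.
have [D HD] := list_sdist_bound (List.concat L); exists D => y Py ry.
have [p [wp lp nd sp]] := reach_nodup ry.
have [wp' nin] := walk_avoid wp.
case: (pselect (p = [::])) => [p0|p0].
  by rewrite p0 /= in lp; case: lp => <-; rewrite sdistxx.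
apply: HD; apply/List.in_concat; exists (inr (base lam) :: inl 1%g :: p); split; last first.
  by right; right; rewrite -lp; apply: last_in.
apply: HL => //; exists p; split=> //; split; last split=> //.
- by constructor=> // -[].
- by rewrite lp; split=> //; case: (p) p0.
Qed.

(** Translation by the inverse of [x] reduces to the coset [P lam] and the element 1; the maximum
    over the finitely many indices is uniform. *)
Lemma coset_angle k : exists D, forall (c : coset P) x y,
  elts (inr c) x -> elts (inr c) y ->
  reach (avoid adj (inr c)) (inl x) (inl y) k -> sdist (inl x) (inl y) <= D.
Proof.
have [D HD] := choice (base_angle ^~ k).
exists (\max_lam D lam) => c x y cx cy xy.
pose lam := (proj1_sig c).1.
have e := coset_base cx.
rewrite -(sdist_act x^-1%g) /= mulVg.
apply: leq_trans (leq_bigmax lam); apply: HD.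
  by have := elts_act x^-1%g cy; rewrite e.
rewrite -e.
have := @reach_map _ _ _ (avoid adj (act x^-1%g (inr c))) (act x^-1%g) (inl x) (inl y) k _ xy.
rewrite /= mulVg; apply=> u v [uv uc vc]; split; first exact: coned_off_act.
- by move=> h; apply: uc; apply: (@act_inj x^-1%g u (inr c) h).
- by move=> h; apply: vc; apply: (@act_inj x^-1%g v (inr c) h).
Qed.

(** * Thin triangles for the [S]-distance *)

Hypothesis connX : forall u v : X, exists n, reach adj u v n.
Variable delta : nat.
Hypothesis thinX : thin adj delta.
Local Notation d := (gdist adj).
Local Notation tri := (gdist_tri connX).

Lemma geo_avoid a b f w i j : geo adj a b f -> i <= j -> j <= d a b ->
  (forall k, i <= k <= j -> f k <> w) -> reach (avoid adj w) (f i) (f j) (j - i).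
Proof.
move=> [_ _ fa] ij jm fw; apply: fun_reach => // k ?.
by split; [apply: fa; lia | apply: fw; lia | apply: fw; lia].
Qed.

Lemma avoid_sym w u v n : reach (avoid adj w) u v n -> reach (avoid adj w) v u n.
Proof. by apply: reach_sym => x y; apply: avoidC; apply: coned_offC. Qed.

(** Every point of a geodesic from [x] to [y] is farther than [k] from [v], and [w] is not. *)
Lemma far_avoid w v x y k l : d v w <= k -> d x y <= l -> l + k < d v x ->
  reach (avoid adj w) x y l.
Proof.
move=> vw xy lt; have [f gf] := geo_ex connX x y; case: (gf) => f0 fm _.
apply: (reach_le xy).
have := @geo_avoid x y f w 0 (d x y) gf isT (leqnn _); rewrite f0 fm subn0; apply=> i im e.
have := tri (f i) v x; rewrite (gdistC coned_offC connX (f i)).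
by rewrite (geo_dist0 connX gf) ?e; lia.
Qed.

(** Follow the side from [f s] towards [f j], the only point of it that may be [w], and stop one
    step early if it is. The length is the absolute value of [s - j] in truncated subtraction. *)
Lemma side_walk a b f w s j : geo adj a b f -> s <= d a b -> j <= d a b ->
  (w = f j -> s <> j) -> (forall k, k <= d a b -> k <> j -> f k <> w) ->
  exists m, [/\ w <> f j -> m = f j,
    w = f j -> adj m w /\ exists2 k, k <= d a b & m = f k &
    reach (avoid adj w) (f s) m ((s - j) + (j - s))].
Proof.
move=> gf sm jm ne fw; case: (gf) => _ _ fa.
case: (pselect (w = f j)) => [wj|wj]; last first.
  exists (f j); split=> //.
  have fw' k : k <= d a b -> f k <> w.
    by move=> km; case: (eqVneq k j) => [->|/eqP]; [exact: nesym | apply: fw].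
  case: (leqP s j) => sj.
    by apply: reach_le (geo_avoid gf sj jm _); [lia | move=> k ?; apply: fw'; lia].
  apply: avoid_sym; apply: reach_le (geo_avoid gf (ltnW sj) sm _); [lia|].
  by move=> k ?; apply: fw'; lia.
have sj := ne wj; case: (ltnP s j) => lt.
  have e : j = j.-1.+1 by lia.
  exists (f j.-1); split=> // [_|].
    by split; [rewrite wj [in X in coned_off _ _ X]e; apply: fa; lia | exists j.-1 => //; lia].
  have sj' : s <= j.-1 by lia.
  by apply: reach_le (geo_avoid gf sj' _ _); [lia | lia | move=> k ?; apply: fw; lia].
exists (f j.+1); split=> // [_|].
  by split; [apply: coned_offC; rewrite wj; apply: fa; lia | exists j.+1 => //; lia].
have sj' : j.+1 <= s by lia.
apply: avoid_sym; apply: reach_le (geo_avoid gf sj' _ _); [lia | lia |].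
by move=> k ?; apply: fw; lia.
Qed.

Definition on_side a b (f : nat -> X) m := exists2 k, k <= d a b & m = f k.

(* A bounded walk from [A i] around [w] to the nearby side point [B j], or to a neighbour of it on
   a side if [w] is that point.  It follows [A] in the direction that avoids [w]. *)
Lemma detour a b c A B C i j w :
  geo adj a b A -> geo adj b c B -> geo adj a c C -> i <= d a b -> j <= d b c ->
  d (A i) (B j) <= delta -> d (A i) w <= delta -> w <> A i ->
  (w = B j \/ ~ on_side b c B w /\ ~ on_side a c C w) ->
  exists m, [/\ w <> B j -> m = B j,
    w = B j -> adj m w /\ (on_side b c B m \/ on_side a c C m) &
    reach (avoid adj w) (A i) m (25 * delta + 6)].
Proof.
move=> gA gB gC im jm vy vw wv wP.
have sym := gdistC coned_offC connX.
set v := A i in vy vw wv *; set y := B j in vy wP *.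
have Bw k : k <= d b c -> k <> j -> B k <> w.
  move=> km kj e; case: wP => [wy|[nB _]]; last by apply: nB; exists k.
  by apply: kj; apply: (geo_inj connX gB) => //; rewrite e.
(* leaving [B j'] far from [v], walk along [B] to [y] or just before it *)
have finB j' l : j' <= d b c -> reach (avoid adj w) v (B j') l -> (w = y -> j' <> j) ->
    l + d (B j') y <= 25 * delta + 6 ->
  exists m, [/\ w <> y -> m = y,
    w = y -> adj m w /\ (on_side b c B m \/ on_side a c C m) &
    reach (avoid adj w) v m (25 * delta + 6)].
  move=> j'm rv ne le.
  have [m [m1 m2 m3]] := side_walk gB j'm jm ne Bw.
  exists m; split=> // [/m2 [? ?]|]; first by split=> //; left.
  apply: reach_le (reach_trans rv m3).
  have : d (B j') y = j' - j + (j - j').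
    case: (leqP j' j) => h; first by rewrite (geo_dist connX gB) //; lia.
    by rewrite sym (geo_dist connX gB (ltnW h)) //; lia.
  lia.
have dv k : k <= d a b -> d v (A k) = (i - k) + (k - i).
  move=> km; case: (leqP i k) => h; first by rewrite (geo_dist connX gA) //; lia.
  by rewrite sym (geo_dist connX gA (ltnW h)) //; lia.
(* If [w] lies on [A] beyond [A i], it does not lie before, so one direction along [A] avoids [w].
   The direction of [b] is treated first. *)
case: (pselect (exists2 i', i < i' <= d a b & w = A i')) => [[i' i'P wi']|right]; last first.
  have Aw k : i <= k -> k <= d a b -> A k <> w.
    move=> ik km e; case: (eqVneq k i) => [ki|ki]; first by apply: wv; rewrite -e ki.
    by apply: right; exists k => //; lia.
  case: (leqP (i + (3 * delta + 1)) (d a b)) => far; last first.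
    have rb : reach (avoid adj w) v (B 0) (3 * delta + 1).
      case: gB => -> _ _; case: (gA) => _ <- _.
      by apply: reach_le (geo_avoid gA im (leqnn _) _); [lia | move=> k ?; apply: Aw; lia].
    have db : d v (B 0) <= 3 * delta + 1.
      by case: gB => -> _ _; case: (gA) => _ <- _; rewrite dv //; lia.
    apply: (finB 0 _ isT rb); last by have := tri v (B 0) y; rewrite (sym (B 0) v); lia.
    move=> wy j0; apply: (Aw (d a b)) => //.
    by case: gA => _ -> _; rewrite wy /y -j0; case: gB.
  (* At distance [3 * delta + 1] from [v], a jump of length [delta] stays farther than [delta] from
     [v], hence avoids [w]. *)
  pose x := A (i + (3 * delta + 1)).
  have dx : d v x = 3 * delta + 1 by rewrite dv //; lia.
  have [sg gs] := geo_ex connX v y.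
  have gA' := geo_sub connX gA im (leqnn _).
  have gB' := geo_sub connX gB (leq0n j) jm.
  have eb : A (d a b) = B 0 by case: gA => _ -> _; case: gB.
  rewrite -eb in gB'.
  have dvb := geo_dist connX gA im (leqnn _).
  case: (thinX gA' gB' gs (i := 3 * delta + 1)); first by rewrite -/v in dvb *; lia.
    move=> [s]; rewrite eb (geo_dist connX gB (leq0n j) jm) subn0 => sj.
    rewrite add0n -/x => xs.
    have rx : reach (avoid adj w) v x (3 * delta + 1).
      have h : i <= i + (3 * delta + 1) by lia.
      by apply: reach_le (geo_avoid gA h far _); [lia | move=> k ?; apply: Aw; lia].
    have lt : delta + delta < d v x by lia.
    have rs := reach_trans rx (far_avoid vw xs lt).
    apply: (finB s _ _ rs); first lia.
      move=> wy sj'; rewrite sj' -/y -wy in xs.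
      by have := tri w v x; rewrite (sym w x); lia.
    have := tri x (B s) y; rewrite (sym (B s) x).
    by have := tri v x y; rewrite (sym x v); lia.
  (* The third side, from [v] to [y], has length at most [delta] and is too close to [v] to be near
     [x]. *)
  move=> [s sm]; rewrite -/x => xs.
  have := tri (sg s) v x; rewrite (geo_dist0 connX gs sm) (sym (sg s) x).
  by rewrite -/v -/y in sm; lia.
have Aw k : k <= i -> A k <> w.
  move=> ki e; have : k = i'; last lia.
  by apply: (geo_inj connX gA); rewrite ?e //; lia.
(* Return to [y] from a point of [C]. If [w] lies on [C], then [w = y] and the walk stops at a
   neighbour of [w] on [C]; otherwise it follows [C] until it can cross to [B]. *)
have finC s l : s <= d a c -> reach (avoid adj w) v (C s) l -> l <= 4 * delta + 1 ->
    d v (C s) <= 4 * delta + 1 -> C s <> w ->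
  exists m, [/\ w <> y -> m = y,
    w = y -> adj m w /\ (on_side b c B m \/ on_side a c C m) &
    reach (avoid adj w) v m (25 * delta + 6)].
  move=> sm rs l4 ds sw.
  have dsy : d (C s) y <= 5 * delta + 1.
    by have := tri v (C s) y; rewrite (sym (C s) v); lia.
  case: (pselect (on_side a c C w)) => [[t tm wt]|wC].
    have wy : w = y by case: wP => // -[_ []]; exists t.
    have Cw k : k <= d a c -> k <> t -> C k <> w.
      by move=> km kt e; apply: kt; apply: (geo_inj connX gC) => //; rewrite e.
    have st : w = C t -> s <> t by move=> _ st; apply: sw; rewrite st.
    have [m [m1 m2 m3]] := side_walk gC sm tm st Cw.
    exists m; split=> // [_|]; first by have [? ?] := m2 wt; split=> //; right.
    apply: reach_le (reach_trans rs m3).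
    have : d (C s) y = s - t + (t - s).
      rewrite -wy wt; case: (leqP s t) => h; first by rewrite (geo_dist connX gC) //; lia.
      by rewrite sym (geo_dist connX gC (ltnW h)) //; lia.
    lia.
  have Cw k : k <= d a c -> C k <> w by move=> km e; apply: wC; exists k.
  have ec : C (d a c) = B (d b c) by case: gC => _ -> _; case: gB => _ ->.
  case: (leqP (s + (7 * delta + 2)) (d a c)) => far; last first.
    have := geo_avoid gC sm (leqnn _) (fun k kP => Cw k (proj2 (andP kP))).
    rewrite ec => /(reach_trans rs) rc; apply: (finB _ _ (leqnn _) rc).
      by move=> wy bj; apply: (Cw (d a c)) => //; rewrite ec bj.
    have := tri (C s) (C (d a c)) y; rewrite (sym (C (d a c)) (C s)).
    by rewrite (geo_dist connX gC sm (leqnn _)) -ec; lia.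
  pose r := C (s + (7 * delta + 2)).
  have ssm : s <= s + (7 * delta + 2) by lia.
  have dr : d (C s) r = 7 * delta + 2 by rewrite (geo_dist connX gC ssm far); lia.
  have dvr : 3 * delta < d v r by have := tri v (C s) r; rewrite (sym (C s) v); lia.
  have [ta gt] := geo_ex connX (C s) y.
  have gC' := geo_sub connX gC sm (leqnn _).
  have gB' := geo_rev coned_offC connX (geo_sub connX gB jm (leqnn _)).
  rewrite -ec in gB'.
  have e1 := geo_dist connX gC sm (leqnn _).
  have e2 := geo_dist connX gB jm (leqnn _).
  case: (thinX gC' gB' gt (i := 7 * delta + 2)); first by rewrite e1; lia.
    move=> [q]; rewrite -/y ec (sym (B (d b c)) y) e2 -/r => qm rq.
    set q' := j + _ in rq.
    have q'm : q' <= d b c by rewrite /q'; lia.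
    have rr : reach (avoid adj w) (C s) r (7 * delta + 2).
      by apply: reach_le (geo_avoid gC ssm far _); [lia | move=> k ?; apply: Cw; lia].
    have lt : delta + delta < d v r by lia.
    have rs' := reach_trans (reach_trans rs rr) (far_avoid vw rq lt).
    (* The longest route, which fixes the constant: [12 * delta + 3] up to [B q'], and from there at
       most [13 * delta + 3] to [y]. *)
    apply: (finB q' _ q'm rs').
      move=> wy qj; rewrite qj -/y -wy in rq.
      by have := tri w v r; rewrite (sym w r); lia.
    have := tri r (B q') y; rewrite (sym (B q') r).
    by have := tri (C s) r y; rewrite (sym r (C s)); lia.
  move=> [q qm]; rewrite -/r => rq.
  have := tri (ta q) (C s) r; rewrite (geo_dist0 connX gt qm) (sym (ta q) r).
  by rewrite -/y in qm; lia.
case: (leqP (3 * delta + 1) i) => far; last first.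
  have e0 : A 0 = C 0 by case: gA => -> _ _; case: gC.
  have r0 := avoid_sym (geo_avoid gA (leq0n i) im (fun k kP => Aw k (proj2 (andP kP)))).
  rewrite e0 in r0; apply: (finC 0 _ isT r0); first lia.
    by rewrite -e0 dv //; lia.
  by rewrite -e0; apply: Aw.
pose x := A (i - (3 * delta + 1)).
have dx : d v x = 3 * delta + 1 by rewrite dv; lia.
have xi : i - (3 * delta + 1) <= i by lia.
have rx : reach (avoid adj w) v x (3 * delta + 1).
  by apply: avoid_sym; apply: reach_le (geo_avoid gA xi im _); [lia | move=> k ?; apply: Aw; lia].
have lt : delta + delta < d v x by lia.
have far' z : d x z <= delta -> 2 * delta < d v z /\ d v z <= 4 * delta + 1.
  by move=> xz; have := tri z v x; rewrite (sym z x); have := tri x v z; lia.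
have xm : i - (3 * delta + 1) <= d a b by lia.
case: (thinX gA gB gC xm) => -[s sm]; rewrite -/x => xs.
  have rs := reach_trans rx (far_avoid vw xs lt).
  have [h1 h2] := far' _ xs.
  apply: (finB s _ sm rs); first by move=> wy sj; rewrite sj -/y in h1; lia.
  by have := tri v (B s) y; rewrite (sym (B s) v); lia.
have rs := reach_trans rx (far_avoid vw xs lt).
have [h1 h2] := far' _ xs.
apply: (finC s _ sm rs) => //; first lia.
by move=> sw; rewrite sw in h1; lia.
Qed.

Local Notation sd := sdist.

Lemma coned_off_inr (c : coset P) (u : X) : adj u (inr c) -> exists2 x, u = inl x & elts (inr c) x.
Proof. by case: u => [x|c'] //= cx; exists x. Qed.

(** A geodesic from [A i] to a nearest point of the other sides has no earlier point on them. At
    each coset it crosses, [detour] closes up to a bounded path around the coset, so the jump there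
    has bounded [S]-length; at most [delta] steps are summed. *)
Lemma sthin_near Da a b c A B C i j g :
  (forall (c : coset P) x y, elts (inr c) x -> elts (inr c) y ->
    reach (avoid adj (inr c)) (inl x) (inl y) (27 * delta + 6) -> sd (inl x) (inl y) <= Da) ->
  geo adj a b A -> geo adj b c B -> geo adj a c C -> i <= d a b -> j <= d b c ->
  d (A i) (B j) <= delta ->
  (forall z, on_side b c B z \/ on_side a c C z -> d (A i) (B j) <= d (A i) z) ->
  A i = inl g ->
  exists2 g', on_side b c B (inl g') \/ on_side a c C (inl g') &
    sd (inl g) (inl g') <= delta * Da.+1 + Da.
Proof.
move=> HDa gA gB gC im jm vy near ig.
set v := A i in vy near ig; set y := B j in vy near.
have [f gf] := geo_ex connX v y; case: (gf) => f0 fm fa.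
have fd t : t <= d v y -> d v (f t) = t by apply: geo_dist0.
have dt t : t <= d v y -> f t <> v -> (f t = y \/ t < d v y) ->
    exists m, [/\ f t <> y -> m = y,
    f t = y -> adj m (f t) /\ (on_side b c B m \/ on_side a c C m) &
    reach (avoid adj (f t)) v m (25 * delta + 6)].
  move=> tm tv tP; apply: (detour gA gB gC) => //; first by rewrite fd //; lia.
  case: tP => [|lt]; [by left | right].
  by split=> h; have := near (f t); rewrite fd //; [move=> /(_ (or_introl h)) | move=> /(_ (or_intror h))]; lia.
have back t t' : t < t' -> t' <= d v y -> reach (avoid adj (f t')) (f t) v delta.
  move=> tt tm; rewrite -f0; apply: avoid_sym.
  have tm' : t <= d v y by lia.
  apply: reach_le (geo_avoid gf (leq0n t) tm' _); first lia.
  move=> k kP e; suff : k = t' by lia.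
  by apply: (geo_inj connX gf) => //; lia.
have step t gt : t <= d v y -> f t = inl gt -> sd (inl g) (inl gt) <= t * Da.+1.
  elim/ltn_ind: t gt => -[|t] IH gt tm ft.
    by move: ft; rewrite f0 ig => -[->]; rewrite sdistxx.
  case ft': (f t) => [x|cc].
    have := IH t (leqnn _) x (ltnW tm) ft'; have := sdist_tri x (inl g) (inl gt).
    have : sd (inl x) (inl gt) <= 1.
      by apply: sdist_cay; have := fa t tm; rewrite ft ft'.
    lia.
  case: t IH tm ft ft' => [|t] IH tm ft ft'; first by move: ft'; rewrite f0 ig.
  have [x ftx cx] : exists2 x, f t = inl x & elts (inr cc) x.
    by apply: coned_off_inr; rewrite -ft'; apply: fa; lia.
  have := IH t (leqnSn _) x _ ftx; have := sdist_tri x (inl g) (inl gt).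
  have : sd (inl x) (inl gt) <= Da; last lia.
  have cg : elts (inr cc) gt by have := fa t.+1 tm; rewrite ft ft'.
  have ney : f t.+1 <> y.
    by move=> e; have := fd t.+1; rewrite e; lia.
  (* Around the coset: back along [f] to [v], the detour to [y], and back along [f] to the vertex
     after the coset, in all [delta + (25 * delta + 6) + delta]. *)
  have [|||m [m1 _ m3]] := dt t.+1.
  - lia.
  - by rewrite ft' ig.
  - by right.
  rewrite (m1 ney) ft' in m3; apply: (HDa cc) => //.
  have b1 := back t t.+1 (leqnn _) (ltnW tm); rewrite ftx ft' in b1.
  have b2 : reach (avoid adj (inr cc)) y (inl gt) delta.
    apply: avoid_sym; rewrite -ft -ft' -fm.
    apply: reach_le (geo_avoid gf tm (leqnn _) _); first lia.
    move=> k kP e; suff : k = t.+1 by lia.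
    by apply: (geo_inj connX gf) => //; lia.
  by apply: reach_le (reach_trans (reach_trans b1 m3) b2); lia.
case ye: y => [g'|cc].
  exists g'; first by left; exists j => //; rewrite -ye.
  by have := step _ g' (leqnn _); rewrite fm => /(_ ye); nia.
(* If the nearest point is a coset, the detour ends at a neighbour of it on a side, which is the
   group element sought. *)
case e: (d v y) => [|t]; first by have := gdist0 connX e; rewrite ye ig.
have [x ftx cx] : exists2 x, f t = inl x & elts (inr cc) x.
  by apply: coned_off_inr; rewrite -ye -fm e; apply: fa; rewrite e.
have [|||m [_ m2 m3]] := dt (d v y); rewrite ?fm ?ye ?ig //.
  by left.
rewrite fm in m2 m3; have [my ms] := m2 erefl.
rewrite ye in my m3; have [g' mg' cg'] := coned_off_inr my; rewrite mg' in ms m3.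
exists g' => //.
have := step t x _ ftx; have := sdist_tri x (inl g) (inl g').
have : sd (inl x) (inl g') <= Da; last by nia.
apply: (HDa cc) => //.
have tlt : t < d v y by rewrite e.
have b1 := back t _ tlt (leqnn _); rewrite fm ye ftx in b1.
by apply: reach_le (reach_trans b1 m3); lia.
Qed.

Lemma sthin : exists D, forall a b c A B C i g,
  geo adj a b A -> geo adj b c B -> geo adj a c C -> i <= d a b -> A i = inl g ->
  exists2 g', on_side b c B (inl g') \/ on_side a c C (inl g') &
    sd (inl g) (inl g') <= D.
Proof.
have [Da HDa] := coset_angle (27 * delta + 6).
exists (delta * Da.+1 + Da) => a b c A B C i g gA gB gC im ig.
pose Q n := exists2 z, on_side b c B z \/ on_side a c C z & d (A i) z = n.
have [n0 Qn0 le0] : exists2 n, Q n & n <= delta.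
  by case: (thinX gA gB gC im) => -[j jm le];
    [exists (d (A i) (B j)) => //; exists (B j) => //; left; exists j
    |exists (d (A i) (C j)) => //; exists (C j) => //; right; exists j].
have [[z zP dz] min] := leastP (ex_intro Q _ Qn0).
have le : d (A i) z <= delta by rewrite dz; apply: leq_trans (min _ Qn0) le0.
have near y : on_side b c B y \/ on_side a c C y -> d (A i) z <= d (A i) y.
  by move=> yP; rewrite dz; apply: min; exists y.
case: zP => -[j jm zj]; rewrite zj in le near.
  exact: (sthin_near HDa gA gB gC im jm le near ig).
(* The nearest point lies on [C]: the same triangle is read from [b], with [A] reversed and [B], [C]
   exchanged. *)
have gA' := geo_rev coned_offC connX gA.
have ei : d a b - (d a b - i) = i by lia.
have im' : d a b - i <= d b a by rewrite (gdistC coned_offC connX b a); lia.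
have := @sthin_near Da b a c _ C B (d a b - i) j g HDa gA' gC gB im' jm.
rewrite /= ei => /(_ le _ ig) [y yP|g' g'P le'].
  by apply: near; case: yP; [right | left].
by exists g' => //; case: g'P; [right | left].
Qed.

Lemma on_side_rev a b f z : on_side a b f z -> on_side b a (fun i => f (d a b - i)) z.
Proof.
move=> [k km ->]; exists (d a b - k); last by congr f; lia.
by rewrite (gdistC coned_offC connX b a); lia.
Qed.

Definition sgeo (a b : X) (q : nat -> G) := [/\ elts a (q 0), elts b (q (sd a b)) &
  forall i, i < sd a b -> cay (q i) (q i.+1)].

Lemma sgeo_ex a b : exists q, sgeo a b q.
Proof.
have [x [y [ax yb xy]]] := sdistP a b.
have [m [q [mn q0 qm qa]]] := reach_fun xy.
suff em : sd a b = m by exists q; split; rewrite ?em ?q0 ?qm.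
apply/eqP; rewrite eqn_leq mn andbT.
apply: (sdist_le_min ax yb).
by have := @fun_reach _ cay q 0 m isT; rewrite subn0 q0 qm; apply=> k; apply: qa.
Qed.

Lemma sgeo_le a b q i j : sgeo a b q -> i <= j -> j <= sd a b ->
  sd (inl (q i)) (inl (q j)) <= j - i.
Proof.
move=> [_ _ qa] ij jm; have := @fun_reach _ cay q i j ij.
by move=> h; apply: (sdist_le_min _ _ (h _)) => // k ?; apply: qa; lia.
Qed.

Lemma sgeo_dist a b q i j : sgeo a b q -> i <= j -> j <= sd a b ->
  [/\ sd (inl (q i)) (inl (q j)) = j - i, sd a (inl (q i)) = i & sd (inl (q j)) b = sd a b - j].
Proof.
move=> gq ij jm; case: (gq) => q0 qm qa.
have := sgeo_le gq ij jm; have im : i <= sd a b by lia.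
have := sgeo_le gq (leq0n i) im; have := sgeo_le gq jm (leqnn _).
have := sdist_elt0 q0.
have : sd (inl (q (sd a b))) b = 0 by rewrite sdistC sdist_elt0.
have := sdist_tri (q 0) a (inl (q i)); have := sdist_tri (q (sd a b)) (inl (q j)) b.
have := sdist_tri (q i) a b; have := sdist_tri (q j) (inl (q i)) b.
by split; lia.
Qed.

Lemma sgeo_left a b q i : sgeo a b q -> i <= sd a b -> sgeo a (inl (q i)) q.
Proof.
move=> gq im; have [_ ei _] := sgeo_dist gq (leqnn i) im.
case: gq => q0 _ qa; split; rewrite ?ei // => k ?; apply: qa; lia.
Qed.

Lemma sgeo_right a b q i : sgeo a b q -> i <= sd a b -> sgeo (inl (q i)) b (fun k => q (i + k)).
Proof.
move=> gq im; have [_ _ ei] := sgeo_dist gq (leqnn i) im.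
case: gq => q0 qm qa; split; rewrite ?addn0 ?ei ?subnKC // => k ?.
by rewrite addnS; apply: qa; lia.
Qed.

(** Such a geodesic has length at most 1: it is the point [x], or the edge from a coset to its
    element [x]. *)
Lemma side_elts a x f g : elts a x -> geo adj a (inl x) f ->
  on_side a (inl x) f (inl g) -> g = x.
Proof.
move=> ax [f0 fm _] [k km e].
have d1 : d a (inl x) <= 1.
  by case: a ax {f0 fm km} => [y /= ->|c cx]; [rewrite (gdistxx connX) | apply: gdist_adj].
case: (eqVneq k (d a (inl x))) => [ke|ne]; first by move: e; rewrite ke fm => -[].
have k0 : k = 0 by lia.
move: e ax; rewrite k0 f0 => <- /= -> //.
Qed.

(** * Coned-off geodesics stay close to [S]-geodesics *)

Section Morse.
Variable D : nat.
Hypothesis sthinD : forall a b c A B C i g,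
  geo adj a b A -> geo adj b c B -> geo adj a c C -> i <= d a b -> A i = inl g ->
  exists2 g', on_side b c B (inl g') \/ on_side a c C (inl g') &
    sd (inl g) (inl g') <= D.

Lemma sthin_rev a b c A B C g :
  geo adj a b A -> geo adj c b B -> geo adj a c C -> on_side a b A (inl g) ->
  exists2 g', on_side c b B (inl g') \/ on_side a c C (inl g') &
    sd (inl g) (inl g') <= D.
Proof.
move=> gA gB gC [i im ig].
have gB' := geo_rev coned_offC connX gB.
have [g' g'P le] := sthinD gA gB' gC im (esym ig); exists g' => //.
case: g'P => [[k km e]|]; [left | by right].
by exists (d c b - k) => //; lia.
Qed.

(** Cut the quadrilateral along the diagonal from [x] to [b]. *)
Lemma squad a b x y A A1 A2 A3 g :
  geo adj a b A -> geo adj a x A1 -> geo adj x y A2 -> geo adj y b A3 ->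
  on_side a b A (inl g) ->
  exists2 g', [\/ on_side a x A1 (inl g'), on_side x y A2 (inl g') | on_side y b A3 (inl g')] &
    sd (inl g) (inl g') <= 2 * D.
Proof.
move=> gA g1 g2 g3 gs; have [B gB] := geo_ex connX x b.
have [g' [g'P|g'P] le] := sthin_rev gA gB g1 gs; last by exists g'; [constructor 1 | lia].
have [g'' g''P le'] := sthin_rev gB g3 g2 g'P.
exists g''; first by case: g''P; [constructor 3 | constructor 2].
by have := sdist_tri g' (inl g) (inl g''); lia.
Qed.

(** Halve the path [k] times: each halving is a thin triangle and costs [D], and a path of length at
    most 1 leaves only its ends. *)
Lemma log_bound (q : nat -> X) k i j A g : i <= j -> j - i <= 2 ^ k ->
  (forall l, i <= l < j -> adj (q l) (q l.+1)) -> geo adj (q i) (q j) A ->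
  on_side (q i) (q j) A (inl g) ->
  exists l g', [/\ i <= l <= j, q l = inl g' & sd (inl g) (inl g') <= D * k].
Proof.
elim: k i j A g => [|k IH] i j A g ij le qa gA gs.
  have d1 : d (q i) (q j) <= 1.
    by apply/(gdist_le connX)/(reach_le (n := 1) _ (fun_reach ij qa)); lia.
  case: gs => l lm e; case: gA => A0 Am _.
  case: (eqVneq l (d (q i) (q j))) => [le'|ne].
    by exists j, g; rewrite sdistxx; split=> //; [lia | rewrite e le'].
  have l0 : l = 0 by lia.
  by exists i, g; rewrite sdistxx; split=> //; [lia | rewrite e l0].
rewrite expnS in le.
have [m [im mj m1 m2]] : exists m, [/\ i <= m, m <= j, m - i <= 2 ^ k & j - m <= 2 ^ k].
  by exists (minn j (i + 2 ^ k)); split; lia.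
have [B gB] := geo_ex connX (q m) (q j); have [C gC] := geo_ex connX (q i) (q m).
have [g' [g'P|g'P] le'] := sthin_rev gA gB gC gs.
  have [|l [g'' [lP e h]]] := IH m j B g' mj m2 _ gB g'P.
    by move=> l ?; apply: qa; lia.
  exists l, g''; split=> //; first lia.
  by have := sdist_tri g' (inl g) (inl g''); lia.
have [|l [g'' [lP e h]]] := IH i m C g' im m1 _ gC g'P.
  by move=> l ?; apply: qa; lia.
exists l, g''; split=> //; first lia.
by have := sdist_tri g' (inl g) (inl g''); lia.
Qed.

(** The cap [L] on the length makes some bound [h] available for each [L]; a bound uniform in [L] is
    what has to be proved. *)
Definition close_upto L h := forall a b q A g, sgeo a b q -> sd a b <= L ->
  geo adj a b A -> on_side a b A (inl g) ->
  exists2 k, k <= sd a b & sd (inl g) (inl (q k)) <= h.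

Lemma sgeo_log a b q i j k A g : sgeo a b q -> i <= j -> j <= sd a b -> j - i <= 2 ^ k ->
  geo adj (inl (q i)) (inl (q j)) A -> on_side (inl (q i)) (inl (q j)) A (inl g) ->
  exists2 l, l <= sd a b & sd (inl g) (inl (q l)) <= D * k.
Proof.
move=> [_ _ qa] ij jm le gA gs.
have [|l [g' [lP [<-] h]]] := log_bound (q := fun l => inl (q l)) ij le _ gA gs.
  by move=> l ?; apply: qa; lia.
by exists l => //; lia.
Qed.

(** Since [L <= 2 ^ L], [L] halvings suffice. The further [2 * D] joins [a] and [b], possibly
    cosets, to the ends of [q]. *)
Lemma close_log L : close_upto L (D * (2 + L)).
Proof.
move=> a b q A g gq le gA gs; case: (gq) => q0 qm _.
have [A1 g1] := geo_ex connX a (inl (q 0)).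
have [A2 g2] := geo_ex connX (inl (q 0)) (inl (q (sd a b))).
have [A3 g3] := geo_ex connX (inl (q (sd a b))) b.
have [g' g'P h] := squad gA g1 g2 g3 gs.
case: g'P => g'P.
- by exists 0 => //; rewrite -(side_elts q0 g1 g'P); nia.
- have le2 : sd a b - 0 <= 2 ^ L by rewrite subn0; apply: leq_trans le (ltnW (ltn_expl _ _)).
  have [l lm h'] := sgeo_log gq (leq0n _) (leqnn _) le2 g2 g'P.
  by exists l => //; have := sdist_tri g' (inl g) (inl (q l)); nia.
- have g3' := geo_rev coned_offC connX g3.
  by exists (sd a b) => //; rewrite -(side_elts qm g3' (on_side_rev g'P)); nia.
Qed.

(** Only a window of radius [r] of [q], around its point near [g], can matter, and there the
    logarithmic bound applies. *)
Lemma close_improve L h k : 2 * (2 * h + 2 * D + 1) <= 2 ^ k ->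
  close_upto L h -> close_upto L (2 * D + D * k).
Proof.
move=> hk cl a b q A g gq le gA gs; case: (gq) => q0 qm _.
have [l lm hl] := cl _ _ _ _ _ gq le gA gs.
pose r := 2 * h + 2 * D + 1.
pose i := l - r; pose j := minn (sd a b) (l + r).
have [A1 g1] := geo_ex connX a (inl (q i)).
have [A2 g2] := geo_ex connX (inl (q i)) (inl (q j)).
have [A3 g3] := geo_ex connX (inl (q j)) b.
have im : i <= sd a b by rewrite /i; lia.
have jm : j <= sd a b by rewrite /j; lia.
have [g' g'P h'] := squad gA g1 g2 g3 gs.
case: g'P => g'P.
(* Unless the window reaches the end of [q], the outer side is excluded: [g'] would be [h]-close to
   [q s] with [s <= l - r], giving [q s] and [q l] a distance of at most [2 * h + 2 * D < r]. *)
- case: (eqVneq i 0) => [i0|i0].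
    by exists 0 => //; move: g1 g'P; rewrite i0 => g1 /(side_elts q0 g1) <-; lia.
  have [_ di _] := sgeo_dist gq (leqnn i) im.
  have leL : sd a (inl (q i)) <= L by lia.
  have [s sm hs] := cl _ _ _ _ _ (sgeo_left gq im) leL g1 g'P.
  have sl : s <= l by rewrite di /i in sm; lia.
  have [dsl _ _] := sgeo_dist gq sl lm.
  have := sdist_tri g' (inl (q s)) (inl (q l)); have := sdist_tri g (inl g') (inl (q l)).
  rewrite (sdistC (inl (q s)) (inl g')) (sdistC (inl g') (inl g)) dsl.
  by rewrite di /i /r in sm i0; rewrite /i /r in i0; lia.
- have ij : i <= j by rewrite /i /j; lia.
  have le2 : j - i <= 2 ^ k by apply: leq_trans hk; rewrite /i /j /r; lia.
  have [l' lm' h''] := sgeo_log gq ij jm le2 g2 g'P.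
  by exists l' => //; have := sdist_tri g' (inl g) (inl (q l')); lia.
- case: (eqVneq j (sd a b)) => [jb|jb].
    rewrite jb in g3 g'P; have g3' := geo_rev coned_offC connX g3.
    by exists (sd a b) => //; rewrite -(side_elts qm g3' (on_side_rev g'P)); lia.
  have {jb} jE : j = l + r by rewrite /j in jb *; lia.
  have [_ _ dj] := sgeo_dist gq (leqnn j) jm.
  have leL : sd (inl (q j)) b <= L by lia.
  have [s sm /= hs] := cl _ _ _ _ _ (sgeo_right gq jm) leL g3 g'P.
  have sl : l <= j + s by lia.
  have jsm : j + s <= sd a b by lia.
  have [dsl _ _] := sgeo_dist gq sl jsm.
  have := sdist_tri g' (inl (q l)) (inl (q (j + s))); have := sdist_tri g (inl (q l)) (inl g').
  rewrite (sdistC (inl (q l)) (inl g)) dsl.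
  by rewrite /r in jE; lia.
Qed.

(** For each [L] the least valid bound cannot exceed [K], as [close_improve] would lower it; and [K]
    does not involve [L]. *)
Lemma morse : exists K, forall L, close_upto L K.
Proof.
have [K HK] := log_lt_linear D; exists K => L.
have [cl min] := leastP (ex_intro (close_upto L) _ (close_log (L := L))).
case: (ltnP K (least (close_upto L))) => lt.
  have [k k1 k2] := HK _ lt.
  by have := leq_ltn_trans (min _ (close_improve k1 cl)) k2; rewrite ltnn.
move=> a b q A g gq le gA gs; have [k km h] := cl _ _ _ _ _ gq le gA gs.
by exists k => //; apply: leq_trans h lt.
Qed.

Lemma sdist_geo_add : exists K, forall a b A g, geo adj a b A -> on_side a b A (inl g) ->
  sd a (inl g) + sd (inl g) b <= sd a b + K.
Proof.
have [K HK] := morse; exists (2 * K) => a b A g gA gs.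
have [q gq] := sgeo_ex a b.
have [k km h] := HK _ _ _ _ _ _ gq (leqnn _) gA gs.
have [_ d1 d2] := sgeo_dist gq (leqnn k) km.
have := sdist_tri (q k) a (inl g); have := sdist_tri (q k) (inl g) b.
by rewrite (sdistC (inl (q k)) (inl g)); lia.
Qed.

(* The last group element on a geodesic to a coset is a coarse nearest-point projection. *)
Lemma coset_projection K u (c : coset P) :
  (forall a b A g, geo adj a b A -> on_side a b A (inl g) ->
    sd a (inl g) + sd (inl g) b <= sd a b + K) ->
  u <> inr c -> exists2 e, elts (inr c) e & forall x, elts (inr c) x ->
    sd u (inl e) + sd (inl e) (inl x) <= sd u (inl x) + (K + 2 * D).
Proof.
move=> HK uc; have [f gf] := geo_ex connX u (inr c); case: (gf) => f0 fm fa.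
case E: (d u (inr c)) => [|t]; first by have := gdist0 connX E.
have [e fe ce] : exists2 e, f t = inl e & elts (inr c) e.
  by apply: coned_off_inr; rewrite -fm E; apply: fa; rewrite E.
exists e => // x cx.
have [B gB] := geo_ex connX (inr c) (inl x); have [C gC] := geo_ex connX u (inl x).
have tm : t <= d u (inr c) by rewrite E.
(* On the side from the coset to [x] the only group element is [x]; on the other side [sd] is
   additive up to [K]. *)
have [g' [g'P|g'P] le] := sthinD gf gB gC tm fe.
  rewrite (side_elts cx gB g'P) in le.
  have := sdist_tri x u (inl e); rewrite (sdistC (inl x) (inl e)); lia.
have := HK _ _ _ _ gC g'P; have := sdist_tri g' u (inl e); have := sdist_tri g' (inl e) (inl x).
by rewrite (sdistC (inl g') (inl e)); lia.
Qed.

(* [z] lies halfway, at distance about [n / 2] from [v], on a coned-off geodesic from [v] to [o];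
   it is the coset crossed there if there is one. *)
Lemma rips_domination_aux K :
  (forall a b A g, geo adj a b A -> on_side a b A (inl g) ->
    sd a (inl g) + sd (inl g) b <= sd a b + K) ->
  forall n, 4 * (K + 2 * D) + 10 <= n -> forall o v, n < sd o v -> exists z,
    (forall u, sd u v <= n -> sd u o <= sd o v -> sd u z <= n) /\
    (forall u, sd u o <= n -> sd u v <= sd o v -> sd u z < sd o v).
Proof.
move=> HK n nN o v nm; pose K' := K + 2 * D; pose h := n %/ 2.
have hn : 2 * h <= n < 2 * h + 2 by rewrite /h; have := divn_eq n 2; have := ltn_mod n 2; lia.
have [f gf] := geo_ex connX v o; case: (gf) => f0 fm fa.
(* In the triangle with third vertex [u], [g] is [D]-close to the side from [o] or from [v] to [u],
   along which [sd] is additive up to [K]. *)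
have near g u : on_side v o f (inl g) ->
    sd o (inl g) + sd u (inl g) <= sd u o + K' \/ sd v (inl g) + sd u (inl g) <= sd u v + K'.
  move=> [i im ig]; have [B gB] := geo_ex connX o u; have [C gC] := geo_ex connX v u.
  have [g' [g'P|g'P] le] := sthinD gf gB gC im (esym ig); [left | right].
    have := HK _ _ _ _ gB g'P; have := sdist_tri g' o (inl g); have := sdist_tri g' (inl g) u.
    rewrite (sdistC (inl g') (inl g)) (sdistC (inl g) u) (sdistC o u) /K'; lia.
  have := HK _ _ _ _ gC g'P; have := sdist_tri g' v (inl g); have := sdist_tri g' (inl g) u.
  rewrite (sdistC (inl g') (inl g)) (sdistC (inl g) u) (sdistC v u) /K'; lia.
(* The least such index gives [g'], the first group element farther than [h] from [v]. *)
pose Q t := t <= d v o /\ exists2 g, f t = inl g & h < sd v (inl g).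
have [|[tm [g' ft' hg']] min] := @leastP Q.
  case eo: o => [g|c].
    by exists (d v o); split=> //; exists g; rewrite ?fm // -eo sdistC; lia.
  case E: (d v o) => [|t].
    by have := gdist0 connX E => vo; rewrite vo sdistxx in nm.
  have [g fg cg] : exists2 g, f t = inl g & elts (inr c) g.
    by apply: coned_off_inr; rewrite -eo -fm E; apply: fa; rewrite E.
  exists t; split; first by rewrite E.
  by exists g => //; have := sdist_elts v cg; rewrite -eo (sdistC v o); lia.
set t' := least Q in tm ft' min.
have ltQ t g : t < t' -> f t = inl g -> sd v (inl g) <= h.
  move=> lt fg; rewrite leqNgt; apply/negP => hg.
  have : t' <= t by apply: min; split; [lia | exists g].
  lia.
have on' : on_side v o f (inl g') by exists t'.
have tri_o x y : sd o v <= sd v (inl x) + sd (inl x) (inl y) + sd o (inl y).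
  have := sdist_tri x v o; have := sdist_tri y (inl x) o.
  by rewrite (sdistC v o) (sdistC (inl y) o); lia.
case et: t' => [|t]; first by move: ft' hg'; rewrite et f0 => ->; rewrite sdistxx.
(* The vertex before [g'] serves as [z]: a group element within [h] of [v], or a coset entered
   within [h] of [v] and left beyond. *)
case ft: (f t) => [g|c].
  have hg : sd v (inl g) <= h by apply: (ltQ t) => //; rewrite et.
  have gg' : sd (inl g) (inl g') <= 1.
    by apply: sdist_cay; have := fa t; rewrite -et ft' ft; apply; lia.
  have tri_u u : sd u (inl g) <= sd u (inl g') + 1.
    by have := sdist_tri g' u (inl g); rewrite (sdistC (inl g') (inl g)); lia.
  exists (inl g); split=> u h1 h2; have := tri_u u; have := tri_o g g'.
    by case: (near g' u on') => h3; rewrite -/K' in nN; lia.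
  by case: (near g' u on') => h3; rewrite -/K' in nN; lia.
have cg' : elts (inr c) g' by have := fa t; rewrite -et ft' ft; apply; lia.
case et2: t => [|t2].
  by move: ft; rewrite et2 f0 => ve; move: hg'; rewrite ve sdist_elt0.
have [g fg cg] : exists2 g, f t2 = inl g & elts (inr c) g.
  by apply: coned_off_inr; rewrite -ft et2; apply: fa; lia.
have hg : sd v (inl g) <= h by apply: (ltQ t2) => //; lia.
have on : on_side v o f (inl g) by exists t2 => //; lia.
have main u : [\/ sd u (inr c) = 0, sd u (inr c) + sd o v <= sd u o + K' + h,
    sd u (inr c) + h <= sd u v + K' | 2 * sd u (inr c) + sd o v <= sd u v + sd u o + 4 * K'].
  case: (pselect (u = inr c)) => [->|uc]; first by constructor 1; rewrite sdistxx.
  have := tri_o g g; rewrite sdistxx => tgg.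
  have ucg := sdist_elts u cg; have ucg' := sdist_elts u cg'.
  case: (near g u on) => n1; first by constructor 2; lia.
  case: (near g' u on') => n2; last by constructor 3; lia.
  (* Entry [g] and exit [g'] are close to different sides. The projection inequalities at [g] and
     [g'] bound twice the distance from [u] to the coset plus the distance from [g] to [g'], and the
     latter completes a path from [v] to [o]. *)
  constructor 4.
  have [e ce He] := coset_projection HK uc.
  have := He g cg; have := He g' cg'; have := sdist_elts u ce.
  have := sdist_tri e (inl g) (inl g'); rewrite (sdistC (inl g) (inl e)).
  by have := tri_o g g'; rewrite -/K'; lia.
exists (inr c); split=> u h1 h2; case: (main u); rewrite -/K' in nN; lia.
Qed.

Lemma rips_domination : exists N, forall n, N <= n -> forall o v, n < sd o v -> exists z,
    (forall u, sd u v <= n -> sd u o <= sd o v -> sd u z <= n) /\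
    (forall u, sd u o <= n -> sd u v <= sd o v -> sd u z < sd o v).
Proof.
have [K HK] := sdist_geo_add; exists (4 * (K + 2 * D) + 10) => n nN o v.
exact: (rips_domination_aux HK nN).
Qed.

End Morse.

(** * Finiteness of the stabiliser of two vertices *)

Fixpoint cball n (g : G) : list G :=
  g :: if n is m.+1 then
         List.flat_map (fun s => cball m (g * s)%g ++ cball m (g * s^-1)%g) S
       else [::].

Lemma cball_in n g x : reach cay g x n -> List.In x (cball n g).
Proof.
elim: n g => [|n IH] g h; first by left; apply: reach0 h.
case: (reachS h) => [->|[y [_ [s [sS e]]] yx]]; [by left | right].
apply/List.in_flat_map; exists s; split=> //; apply/List.in_or_app.
case: e => [<-|e]; [by left; apply: IH | right; apply: IH].
by rewrite e mulgK.
Qed.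

(** Group elements have trivial stabilisers. For two cosets let [x] follow [c] on a geodesic to
    [c']: if [h] fixes both, the geodesic and its translate join [x] to [h * x] around [c], so the
    angle bound puts [h * x] in a finite ball. *)
Lemma stab2_finite (u v : X) : u <> v ->
  exists l : list G, forall h, act h u = u -> act h v = v -> List.In h l.
Proof.
have stab1 g h : act h (inl g : X) = inl g -> h = 1%g.
  by case=> e; apply: (@mulIg _ g); rewrite e mul1g.
case: u v => [g|c] [g'|c'] ne; try by exists [:: 1%g] => h e e'; left; rewrite ?(stab1 _ _ e) ?(stab1 _ _ e').
have [f gf] := geo_ex connX (inr c) (inr c'); case: (gf) => f0 fm fa.
case E: (d (inr c) (inr c')) => [|m]; first by have := gdist0 connX E.
have [x fx cx] : exists2 x, f 1 = inl x & elts (inr c) x.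
  by apply: coned_off_inr; apply: coned_offC; rewrite -f0; apply: fa; rewrite E.
have [Dm HDm] := coset_angle (m + m).
exists [seq (y * x^-1)%g | y <- cball Dm x] => h hc hc'.
apply/List.in_map_iff; exists (h * x)%g; split; first by rewrite mulgK.
apply: cball_in.
have [a [b [/= -> -> ab]]] := sdistP (inl x) (inl (h * x)%g).
apply: reach_le ab; apply: (HDm c) => //.
  by have := elts_act h cx; rewrite hc.
have lt1 : 1 <= d (inr c) (inr c') by rewrite E.
have r1 : reach (avoid adj (inr c)) (inl x) (inr c') m.
  rewrite -fx -fm; apply: reach_le (geo_avoid gf lt1 (leqnn _) _); first by rewrite E; lia.
  move=> k kP e; suff : k = 0 by lia.
  by apply: (geo_inj connX gf) => //; [lia | rewrite e f0].
apply: (reach_trans r1); apply: avoid_sym; rewrite -[X in reach _ _ X]hc'.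
rewrite -[inl (h * x)%g]/(act h (inl x : X)).
apply: reach_map r1 => y z [yz yc zc]; split; first exact: coned_off_act.
- by move=> e; apply: yc; apply: (@act_inj h); rewrite hc.
- by move=> e; apply: zc; apply: (@act_inj h); rewrite hc.
Qed.

End ConedOff.

(** * Homotopies of the realization *)

Lemma In_mem (T : eqType) (x : T) (l : seq T) : List.In x l <-> x \in l.
Proof.
elim: l => [|y l IH] //=; rewrite in_cons; split.
  by case=> [->|/IH ->]; rewrite ?eqxx ?orbT.
by case/orP => [/eqP ->|/IH]; [left | right].
Qed.

Lemma NoDup_uniq (T : eqType) (l : seq T) : List.NoDup l <-> uniq l.
Proof.
elim: l => [|y l IH] /=; first by split=> // _; constructor.
split=> [nd|/andP [nin /IH nd]].
  by inversion nd as [|? ? nin ndl]; apply/andP; split; [apply/negP => /In_mem | apply/IH].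
by constructor=> // /In_mem; apply/negP.
Qed.

Section Sums.
Local Open Scope ring_scope.
Variables (R : nmodType) (V : Type).

(** Both are sums over the support; [{classic V}] provides the equality needed to filter lists of a
    bare type. *)
Lemma sum_supp (f : V -> R) (l1 l2 : list V) : List.NoDup l1 -> List.NoDup l2 ->
  (forall v, f v <> 0 -> List.In v l1) -> (forall v, f v <> 0 -> List.In v l2) ->
  \sum_(v <- l1) f v = \sum_(v <- l2) f v.
Proof.
pose T : eqType := {classic V}; pose F : T -> R := f.
move=> /(NoDup_uniq (T := T)) u1 /(NoDup_uniq (T := T)) u2 h1 h2.
have E (l : seq T) : \sum_(v <- l) F v = \sum_(v <- [seq v <- l | F v != 0]) F v.
  rewrite big_filter [LHS](bigID (fun v => F v != 0)) /= [X in _ + X]big1 ?addr0 //.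
  by move=> v /negPn/eqP.
rewrite -[LHS]/(\sum_(v <- (l1 : seq T)) F v) -[RHS]/(\sum_(v <- (l2 : seq T)) F v).
rewrite (E l1) (E l2); apply: perm_big; apply: uniq_perm; rewrite ?filter_uniq // => v.
rewrite !mem_filter; case: eqP => //= ne.
have /In_mem -> : List.In (v : T) (l1 : seq T) by apply: h1.
by have /In_mem -> : List.In (v : T) (l2 : seq T) by apply: h2.
Qed.

End Sums.

(* A Markov kernel on the vertices depending continuously on time and mapping
   simplices to simplices induces a homotopy of the realization. *)
Section KernelHomotopy.
Local Open Scope ring_scope.
Local Open Scope classical_set_scope.
Variables (R : realType) (V : Type) (adj : V -> V -> Prop).
Local Notation T := (realization R adj).
Variables (c : V -> R -> V -> R) (L : V -> list V).
Hypothesis c_ge0 : forall u t v, 0 <= c u t v.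
Hypothesis L_nodup : forall u, List.NoDup (L u).
Hypothesis c_supp : forall u t v, c u t v <> 0 -> List.In v (L u).
Hypothesis c_sum : forall u t, \sum_(v <- L u) c u t v = 1.
Hypothesis c_cont : forall u v, continuous (fun t => c u t v).
Hypothesis c_clique : forall u u' v v' t, u = u' \/ adj u u' ->
  c u t v <> 0 -> c u' t v' <> 0 -> v = v' \/ adj v v'.

Definition supp (x : T) : list V := sval (cid (proj2 (proj2_sig x))).

Lemma suppP (x : T) : [/\ List.NoDup (supp x), clique adj (supp x),
  forall v, proj1_sig x v <> 0 -> List.In v (supp x) &
  \sum_(v <- supp x) proj1_sig x v = 1].
Proof. by rewrite /supp; case: cid => l /= [? [? [? ?]]]. Qed.

Definition push (x : T) (t : R) (v : V) : R :=
  \sum_(u <- supp x) proj1_sig x u * c u t v.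

Lemma pushE (l : list V) (x : T) t v : List.NoDup l -> closed_simplex l x ->
  push x t v = \sum_(u <- l) proj1_sig x u * c u t v.
Proof.
move=> nd lx; have [nd' _ s _] := suppP x; apply: sum_supp => // u ne.
- by apply: s => e; apply: ne; rewrite e mul0r.
- by apply: lx => e; apply: ne; rewrite e mul0r.
Qed.

(** A finite set containing the images of the simplex at all times; it need not be a clique. *)
Definition carrier (l : list V) : list V :=
  undup (flatten [seq L u | u <- l] : seq {classic V}).

Lemma carrier_nodup l : List.NoDup (carrier l).
Proof. by apply/(NoDup_uniq (T := {classic V})); apply: undup_uniq. Qed.

Lemma carrier_in l u v : List.In u l -> List.In v (L u) -> List.In v (carrier l).
Proof.
move=> /(In_mem (T := {classic V})) ul /(In_mem (T := {classic V})) vu.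
apply/(In_mem (T := {classic V})); rewrite mem_undup.
by apply/(@flatten_mapP {classic V} {classic V} L); exists u.
Qed.

Lemma push_neq0 x t v : push x t v <> 0 ->
  exists u, [/\ List.In u (supp x), proj1_sig x u <> 0 & c u t v <> 0].
Proof.
move=> ne; apply: contrapT => h; apply: ne; rewrite /push.
have hx u : List.In u (supp x) -> proj1_sig x u * c u t v = 0.
  move=> ui; apply: contrapT => ne; apply: h; exists u; split=> // e; apply: ne.
    by rewrite e mul0r.
  by rewrite e mulr0.
elim: (supp x) hx => [|u l IH] hx; first by rewrite big_nil.
by rewrite big_cons hx ?IH ?addr0 //; [move=> u' ?; apply: hx; right | left].
Qed.

Lemma push_carrier l x t v : closed_simplex l x -> push x t v <> 0 -> List.In v (carrier l).
Proof.
by move=> lx /push_neq0 [u [_ xu cu]]; apply: carrier_in (lx _ xu) (c_supp cu).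
Qed.

Lemma push_pt x t : is_pt adj (push x t).
Proof.
have [nd cl s s1] := suppP x.
split=> [v|]; first by apply: sumr_ge0 => u _; apply: mulr_ge0 => //; case: (proj2_sig x).
(* The carrier may fail to be a clique, but the vertices of nonzero mass at the one time [t] form
   one by [c_clique]. *)
pose l : list V := [seq v <- (carrier (supp x) : seq {classic V}) | push x t v != 0].
have lP v : List.In v l <-> push x t v <> 0.
  rewrite (In_mem (T := {classic V})) mem_filter; split=> [/andP [/eqP]//|ne].
  apply/andP; split; first exact/eqP.
  by apply/(In_mem (T := {classic V})); apply: push_carrier ne.
have ndl : List.NoDup l.
  apply/(NoDup_uniq (T := {classic V})); apply: filter_uniq.
  by apply/(NoDup_uniq (T := {classic V})); apply: carrier_nodup.
exists l; split=> //; split; [|split].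
- move=> v v' /lP/push_neq0 [u [us xu cu]] /lP/push_neq0 [u' [us' xu' cu']] ne.
  have uu : u = u' \/ adj u u'.
    by case: (pselect (u = u')) => h; [left | right; apply: cl].
  by case: (c_clique uu cu cu').
- by move=> v /lP.
rewrite (@sum_supp _ _ (push x t) l (carrier (supp x)) ndl (carrier_nodup _)).
- rewrite /push exchange_big /= -s1; apply: eq_bigr => u _.
  rewrite -mulr_sumr.
  case: (pselect (proj1_sig x u = 0)) => [->|xu]; first by rewrite mul0r.
  have us := s _ xu.
  rewrite (@sum_supp _ _ (c u t) (carrier (supp x)) (L u)) ?c_sum ?mulr1 //.
  + exact: carrier_nodup.
  + by move=> v /c_supp; apply: carrier_in us.
  + by move=> v /c_supp.
- by move=> v /lP.
- by move=> v; apply: push_carrier.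
Qed.

Definition kflow (xt : T * R) : T := exist _ (push xt.1 xt.2) (push_pt xt.1 xt.2).

Let G l v (ys : 'rV[R]_(size l) * R) : R :=
  \sum_(i < size l) ys.1 ord0 i * c (tnth (in_tuple l) i) ys.2 v.

Let G_cont l v : continuous (@G l v).
Proof.
move=> ys; apply: cvg_big => [|i _]; first exact: add_continuous.
apply: cvgM.
  apply: (@cvg_comp _ _ _ fst (fun y : 'rV[R]_(size l) => y ord0 i) _ (nbhs ys.1)).
    exact: cvg_fst.
  exact: coord_continuous.
apply: (@cvg_comp _ _ _ snd (fun t => c (tnth (in_tuple l) i) t v) _ (nbhs ys.2)).
  exact: cvg_snd.
exact: c_cont.
Qed.

Let GE l v (x : T) t : List.NoDup l -> closed_simplex l x ->
  push x t v = @G l v (coords l x, t).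
Proof.
move=> nd lx; rewrite (pushE _ _ nd lx) /G big_tnth /=.
by apply: eq_bigr => i _; rewrite mxE.
Qed.

(** Images of [l] lie in simplices spanned by the finitely many sublists of the carrier. For each
    sublist, either the image of [x0] lies in its simplex and [U] is open there, or some coordinate
    outside it is nonzero and stays so nearby. *)
Let kflow_near l (U : set T) x0 t0 : List.NoDup l -> clique adj l ->
  closed_simplex l x0 -> weak_open U -> U (kflow (x0, t0)) ->
  \forall ys \near (coords l x0, t0), forall x, closed_simplex l x ->
    coords l x = ys.1 -> U (kflow (x, ys.2)).
Proof.
move=> nd cl lx0 oU Ux0.
pose M := carrier l.
suff H : \forall ys \near (coords l x0, t0), forall m : (size M).-tuple bool,
    forall x, closed_simplex l x -> coords l x = ys.1 -> clique adj (mask m M) ->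
    closed_simplex (mask m M) (kflow (x, ys.2)) -> U (kflow (x, ys.2)).
  apply: filterS H => ys H x lx xe.
  pose a v := push x ys.2 v != 0.
  have sz : size (map a M) == size M by rewrite size_map.
  have e : mask (Tuple sz) M = [seq v <- M | a v] by rewrite filter_mask.
  have clP v : List.In v [seq v <- M | a v] <-> push x ys.2 v <> 0.
    rewrite (In_mem (T := {classic V})) mem_filter; split=> [/andP [/eqP]//|ne].
    apply/andP; split; first exact/eqP.
    by apply/(In_mem (T := {classic V})); apply: push_carrier ne.
  apply: (H (Tuple sz) x lx xe); rewrite e.
    move=> v v' /clP/push_neq0 [u [us xu cu]] /clP/push_neq0 [u' [us' xu' cu']] ne.
    have uu : u = u' \/ adj u u'.
      by case: (pselect (u = u')) => h; [left | right; apply: cl => //; apply: lx].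
    by case: (c_clique uu cu cu').
  by move=> v /= ne; apply/clP.
apply: (@filter_forall _ _ _ (nbhs (coords l x0, t0)) (nbhs_filter _)) => m.
case: (pselect (clique adj (mask m M))) => [clm|]; last by move=> ncl; apply: nearW => ys x _ _.
have ndm : List.NoDup (mask m M).
  apply/(NoDup_uniq (T := {classic V})); apply: mask_uniq.
  by apply/(NoDup_uniq (T := {classic V})); apply: carrier_nodup.
set s := mask m M in clm ndm *.
case: (pselect (closed_simplex s (kflow (x0, t0)))) => [sx0|sx0]; last first.
  have [v [vs ne]] : exists v, ~ List.In v s /\ push x0 t0 v <> 0.
    apply: contrapT => h; apply: sx0 => v ne; apply: contrapT => h'; apply: h.
    by exists v.
  have : \forall ys \near (coords l x0, t0), @G l v ys != 0.
    apply: (@G_cont l v (coords l x0, t0) [set r | r != 0]).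
    apply: open_nbhs_nbhs; split; first exact: open_neq.
    by rewrite /= -GE //; apply/eqP.
  apply: filterS => ys /eqP Gne x lx xe _ sx; case: vs; apply: sx => /=.
  by rewrite (GE _ _ nd lx) xe; case: (ys) Gne.
have [W [oW UW]] := oU s ndm clm.
have W0 : W (coords s (kflow (x0, t0))).
  have : (U `&` closed_simplex s) (kflow (x0, t0)) by [].
  by rewrite UW => -[].
have [Q Qn QW] : nbhs (coords s (kflow (x0, t0))) W by apply: open_nbhs_nbhs.
have : \forall ys \near (coords l x0, t0), forall j : 'I_(size s),
    Q ord0 j (@G l (tnth (in_tuple s) j) ys).
  apply: (@filter_forall _ _ _ (nbhs (coords l x0, t0)) (nbhs_filter _)) => j; apply: G_cont.
  by have := Qn ord0 j; rewrite mxE /= (GE _ _ nd lx0).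
apply: filterS => ys H x lx xe _ sx.
suff : (U `&` closed_simplex s) (kflow (x, ys.2)) by case.
rewrite UW; split=> //; apply: QW => i j; rewrite ord1 mxE /= (GE _ _ nd lx) xe.
by case: (ys) (H j).
Qed.

(** The weak topology is tested simplex by simplex, the product topology is not. A compact time
    interval [K] mediates: by the tube lemma on each simplex, the points sent into [U] throughout
    [K] form a weakly open set. *)
Lemma kflow_continuous : continuous kflow.
Proof.
move=> [x0 t0] A; rewrite /= {1}nbhsE => -[U [oU Ux0] UA].
have oU' : weak_open U := oU.
have [nd0 cl0 s0 _] := suppP x0.
have : \forall t \near t0, U (kflow (x0, t)).
  have := kflow_near nd0 cl0 s0 oU' Ux0.
  case=> -[B C] /= [Bn Cn] BC; apply: filterS Cn => t Ct.
  by apply: (BC (coords (supp x0) x0, t)) => //=; split=> //; apply: nbhs_singleton.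
move=> /nbhs_ballP [e /= e0 eU].
pose K := `[t0 - e / 2, t0 + e / 2]%classic.
pose U' := [set x : T | forall t, K t -> U (kflow (x, t))].
have U'x0 : U' x0.
  move=> t; rewrite /K /= in_itv /= => /andP [t1 t2]; apply: eU; rewrite /ball /=.
  by rewrite ltr_norml; apply/andP; split; lra.
have U'o : weak_open U'.
  move=> l nd cl.
  pose Pl := [set y : 'rV[R]_(size l) | forall x, closed_simplex l x -> coords l x = y -> U' x].
  exists (Pl°); split; first exact: open_interior.
  apply/seteqP; split=> x [h1 h2]; split=> //; last by apply: (interior_subset h1).
  have : \forall y \near coords l x, K `<=`
      (fun t => forall x', closed_simplex l x' -> coords l x' = y -> U (kflow (x', t))).
    have /compact_near_coveringP nc : compact K by apply: segment_compact.
    apply: (nc _ (nbhs (coords l x)) (fun y t => forall x', closed_simplex l x' ->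
      coords l x' = y -> U (kflow (x', t)))) => t Kt.
    have [[B C] /= [Bn Cn] BC] := kflow_near nd cl h2 oU' (h1 t Kt).
    by exists (C, B) => // -[t' y] /= [Ct By]; apply: (BC (y, t')).
  by apply: filterS => y H x' lx' xe t Kt; apply: H.
exists (U', K) => /=.
  split; first by apply: open_nbhs_nbhs.
  apply/nbhs_ballP; exists (e / 2) => /=; first lra.
  move=> t; rewrite /ball /= ltr_norml => /andP [t1 t2].
  by rewrite /K /= in_itv /=; apply/andP; split; lra.
by move=> [x t] /= [U'x Kt]; apply: UA; apply: U'x.
Qed.

End KernelHomotopy.

(** * Time schedule of the levels *)

Section Ramp.
Local Open Scope ring_scope.
Variable R : realType.

(* Rises from 0 to 1 on [1/(k+2), 1/(k+1)], so that higher levels move strictly before lower ones. *)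
Definition ramp (k : nat) (t : R) : R :=
  Num.min 1 (Num.max 0 ((t * k.+2%:R - 1) * k.+1%:R)).

Lemma ramp_ge0 k t : 0 <= ramp k t.
Proof. by rewrite /ramp le_min ler01 le_max lexx. Qed.

Lemma ramp_le1 k t : ramp k t <= 1.
Proof. by rewrite /ramp ge_min lexx. Qed.

Lemma ramp0 k : ramp k 0 = 0.
Proof.
rewrite /ramp mul0r sub0r mulN1r (max_idPl _) ?oppr_le0 ?ler0n //.
by apply/min_idPr; apply: ler01.
Qed.

Lemma ramp1 k : ramp k 1 = 1.
Proof.
rewrite /ramp mul1r; apply/min_idPl; rewrite le_max; apply/orP; right.
have -> : k.+2%:R - 1 = k.+1%:R :> R by rewrite -[k.+2]addn1 natrD addrK.
by rewrite -natrM ler1n.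
Qed.

(** The ramp of level [k] is complete at time [1/(k+1)], and that of [k'] starts at [1/(k'+2)],
    which is no earlier. *)
Lemma ramp_order k k' t : (k' < k)%N -> ramp k t <> 1 -> ramp k' t = 0.
Proof.
move=> lt ne.
have k1 : 0 < k.+1%:R :> R by rewrite ltr0n.
have tk : t * k.+1%:R < 1.
  rewrite ltNge; apply/negP => le; apply: ne; rewrite /ramp; apply/min_idPl.
  rewrite le_max; apply/orP; right.
  have -> : k.+2%:R = k.+1%:R + 1 :> R by rewrite -[k.+2]addn1 natrD.
  have t0 : 0 < t by rewrite -(pmulr_lgt0 _ k1); lra.
  nra.
have kk : k'.+2%:R <= k.+1%:R :> R by rewrite ler_nat.
have k2 : 0 < k'.+2%:R :> R by rewrite ltr0n.
have k3 : 0 < k'.+1%:R :> R by rewrite ltr0n.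
have tk' : t * k'.+2%:R < 1.
  by case: (lerP 0 t) => t0; nra.
rewrite /ramp (max_idPl _); first by apply/min_idPr; apply: ler01.
by nra.
Qed.

Lemma ramp_continuous k : continuous (ramp k).
Proof.
move=> t; pose g (t : R) : R := (t * k.+2%:R - 1) * k.+1%:R.
apply: (@continuous_min R R (fun=> 1) ((fun=> 0) \max g)); first exact: cvg_cst.
apply: (@continuous_max R R (fun=> 0) g); first exact: cvg_cst.
apply: cvgM; last exact: cvg_cst.
by apply: cvgB; [apply: cvgM; [exact: cvg_id | exact: cvg_cst] | exact: cvg_cst].
Qed.

End Ramp.

Lemma eq_big_In (R : nmodType) (V : Type) (l : list V) (f g : V -> R) :
  (forall v, List.In v l -> f v = g v) -> (\sum_(v <- l) f v = \sum_(v <- l) g v)%R.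
Proof.
elim: l => [|u l IH] h; rewrite ?big_nil // !big_cons h; last by left.
by rewrite IH // => v vl; apply: h; right.
Qed.

Lemma NoDup_perm (V : Type) (l1 l2 : list V) : List.NoDup l1 -> List.NoDup l2 ->
  (forall v, List.In v l1 <-> List.In v l2) -> perm_eq (l1 : seq {classic V}) l2.
Proof.
move=> /(NoDup_uniq (T := {classic V})) u1 /(NoDup_uniq (T := {classic V})) u2 h.
apply: uniq_perm => // v; apply/idP/idP;
  by move=> /(In_mem (T := {classic V}))/h/(In_mem (T := {classic V})).
Qed.

Lemma NoDup_map (V : Type) (a : V -> V) (l : list V) :
  injective a -> List.NoDup l -> List.NoDup (map a l).
Proof.
move=> ainj /(NoDup_uniq (T := {classic V})) u; apply/(NoDup_uniq (T := {classic V})).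
by rewrite (@map_inj_uniq {classic V} {classic V} a ainj).
Qed.

Lemma finite_list (V : Type) (A : V -> Prop) (l : list V) :
  (forall v, A v -> List.In v l) ->
  exists l', List.NoDup l' /\ forall v, List.In v l' <-> A v.
Proof.
move=> h; exists (undup ([seq v <- l | `[< A v >]] : seq {classic V})); split.
  by apply/(NoDup_uniq (T := {classic V})); apply: undup_uniq.
move=> v; rewrite (In_mem (T := {classic V})) mem_undup mem_filter; split.
  by case/andP => /asboolP.
move=> Av; apply/andP; split; first exact/asboolP.
by apply/(In_mem (T := {classic V})); apply: h.
Qed.

Section FiniteMass.
Local Open Scope ring_scope.
Variables (R : realType) (V : Type).

(** One finite list contains the support at all times, as the kernel homotopy demands. *)
Definition has_mass (f : R -> V -> R) (m : R -> R) := exists l : list V,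
  [/\ List.NoDup l, forall t v, f t v <> 0 -> List.In v l &
      forall t, \sum_(v <- l) f t v = m t].

Lemma has_mass_le f m l : has_mass f m -> List.NoDup l ->
  (forall t v, f t v <> 0 -> List.In v l) -> forall t, \sum_(v <- l) f t v = m t.
Proof.
move=> [l' [nd' s' e']] nd s t; rewrite -e'; apply: sum_supp => // v; [exact: s | exact: s'].
Qed.

Lemma has_massD f g m m' : has_mass f m -> has_mass g m' ->
  has_mass (fun t v => f t v + g t v) (fun t => m t + m' t).
Proof.
move=> fm gm; have [l [_ sl _]] := fm; have [l' [_ sl' _]] := gm.
have [l2 [nd l2P]] := @finite_list V (fun v => List.In v (l ++ l')) _ (fun _ => id).
have s1 t v : f t v <> 0 -> List.In v l2.
  by move=> ne; apply/l2P/List.in_or_app; left; apply: sl ne.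
have s2 t v : g t v <> 0 -> List.In v l2.
  by move=> ne; apply/l2P/List.in_or_app; right; apply: sl' ne.
exists l2; split=> // [t v ne|t].
  case: (pselect (f t v = 0)) => [f0|]; last exact: s1.
  by apply: (s2 t) => g0; apply: ne; rewrite f0 g0 addr0.
by rewrite big_split /= (has_mass_le fm nd s1) (has_mass_le gm nd s2).
Qed.

Lemma has_massZ f m (a : R -> R) : has_mass f m ->
  has_mass (fun t v => a t * f t v) (fun t => a t * m t).
Proof.
move=> [l [nd s e]]; exists l; split=> // [t v ne|t]; last by rewrite -mulr_sumr e.
by apply: (s t) => f0; apply: ne; rewrite f0 mulr0.
Qed.

Lemma has_mass_sum (I : Type) (r : list I) (f : I -> R -> V -> R) (m : I -> R -> R) :
  (forall i, List.In i r -> has_mass (f i) (m i)) ->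
  has_mass (fun t v => \sum_(i <- r) f i t v) (fun t => \sum_(i <- r) m i t).
Proof.
elim: r => [|i r IH] h.
  exists [::]; split; [constructor| |] => [t v|t]; rewrite !big_nil //.
have [l [nd s e]] := has_massD (h i (or_introl erefl)) (IH (fun j jr => h j (or_intror jr))).
exists l; split=> // [t v|t]; first by rewrite big_cons; apply: s.
by rewrite big_cons -e; apply: eq_bigr => v _; rewrite big_cons.
Qed.

Lemma has_mass_ext f g m m' : f =2 g -> m =1 m' -> has_mass f m -> has_mass g m'.
Proof.
move=> fg mm [l [nd s e]]; exists l; split=> // [t v|t]; first by rewrite -fg; apply: s.
by rewrite -mm -e; apply: eq_bigr => v _; rewrite fg.
Qed.

End FiniteMass.

(** * Deformation to the apex through dominating vertices *)

Section Dismantle.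
Local Open Scope ring_scope.
Local Open Scope classical_set_scope.
Variables (R : realType) (V : Type) (adj : V -> V -> Prop).
Hypothesis adjC : forall u v, adj u v -> adj v u.
Local Notation T := (realization R adj).
Local Notation near u v := (u = v \/ adj u v).
Variables (n : nat) (lev : V -> nat) (p : T) (Z : V -> list V).
Local Notation pt := (proj1_sig p).
Hypothesis p_lev : forall v, pt v <> 0 -> (lev v <= n)%N.
Hypothesis p_near : forall u v, (lev u <= n)%N -> pt v <> 0 -> near u v.
Hypothesis Z_nodup : forall u, (n < lev u)%N -> List.NoDup (Z u).
Hypothesis Z_nil : forall u, (n < lev u)%N -> Z u <> [::].
Hypothesis Z_lev : forall u z, (n < lev u)%N -> List.In z (Z u) -> (lev z < lev u)%N.
Hypothesis Z_dom : forall u z u', (n < lev u)%N -> List.In z (Z u) -> near u u' ->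
  (lev u' <= lev u)%N -> near z u'.

Let dirac (u v : V) : R := (`[< u = v >])%:R.

(** Mass at a vertex above level [n] passes evenly to [Z u] and flows on from there; at lower levels
    it goes straight to [p]. Each pass lowers the level, so fuel [lev u] suffices and the value 0
    for exhausted fuel does not enter [kern]. *)
Fixpoint kern_fuel (k : nat) (u : V) (t : R) (v : V) : R :=
  if (n < lev u)%N then
    if k is k'.+1 then
      (1 - ramp (lev u) t) * dirac u v +
      ramp (lev u) t * ((size (Z u))%:R^-1 * \sum_(z <- Z u) kern_fuel k' z t v)
    else 0
  else (1 - ramp n t) * dirac u v + ramp n t * pt v.

Definition kern u := kern_fuel (lev u) u.

Lemma kern_fuelE k k' u t v : (lev u <= k)%N -> (lev u <= k')%N ->
  kern_fuel k u t v = kern_fuel k' u t v.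
Proof.
elim: k k' u => [|k IH] [|k'] u uk uk' //=; try by have -> : (n < lev u)%N = false by lia.
case: ifP => // nu; congr (_ + _ * (_ * _)); apply: eq_big_In => z zZ.
by have := Z_lev nu zZ => ?; apply: IH; lia.
Qed.

Lemma kern_low u t v : (lev u <= n)%N ->
  kern u t v = (1 - ramp n t) * dirac u v + ramp n t * pt v.
Proof. by rewrite /kern leqNgt => /negbTE un; case: {1}(lev u) => [|k] /=; rewrite un. Qed.

Lemma kern_high u t v : (n < lev u)%N ->
  kern u t v = (1 - ramp (lev u) t) * dirac u v +
    ramp (lev u) t * ((size (Z u))%:R^-1 * \sum_(z <- Z u) kern z t v).
Proof.
move=> nu; rewrite /kern; case E: {1}(lev u) => [|k]; first by rewrite E in nu.
rewrite /= nu; congr (_ + _ * (_ * _)); apply: eq_big_In => z zZ.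
by have := Z_lev nu zZ => ?; apply: kern_fuelE; lia.
Qed.

Lemma lev_ind (Q : V -> Prop) : (forall u, (lev u <= n)%N -> Q u) ->
  (forall u, (n < lev u)%N -> (forall z, List.In z (Z u) -> Q z) -> Q u) -> forall u, Q u.
Proof.
move=> low high u; have [m] := ubnP (lev u); elim: m u => // m IH u um.
case: (ltnP n (lev u)) => nu; last exact: low.
by apply: high => // z zZ; apply: IH; have := Z_lev nu zZ; lia.
Qed.

Let size_gt0 u : (n < lev u)%N -> 0 < (size (Z u))%:R :> R.
Proof. by move=> /Z_nil; rewrite ltr0n; case: (Z u). Qed.

Lemma kern_ge0 u t v : 0 <= kern u t v.
Proof.
have r0 := ramp_ge0 (R := R); have r1 k : 0 <= 1 - ramp k t by rewrite subr_ge0 ramp_le1.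
elim/lev_ind: u => u nu => [|IH].
  by rewrite kern_low // addr_ge0 // mulr_ge0 // ?ler0n //; case: (proj2_sig p).
rewrite kern_high // addr_ge0 // mulr_ge0 // ?ler0n // mulr_ge0 ?invr_ge0 ?ler0n //.
elim: (Z u) IH => [|z l IHl] IH; first by rewrite big_nil.
rewrite big_cons addr_ge0 //; first by apply: IH; left.
by apply: IHl => z' ?; apply: IH; right.
Qed.

Lemma kern_mass u : has_mass (kern u) (fun=> 1).
Proof.
have mdirac w : has_mass (fun=> dirac w) (fun=> 1).
  exists [:: w]; split; first by constructor=> //; constructor.
    by rewrite /dirac => _ v; case: asboolP => // ->; left.
  by move=> _; rewrite big_seq1 /dirac asboolT.
have mp : has_mass (fun=> pt) (fun=> 1).
  by have [? ? ? ?] := suppP p; exists (supp p).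
elim/lev_ind: u => u nu => [|IH].
  apply: has_mass_ext (has_massD (has_massZ (fun t => 1 - ramp n t) (mdirac u))
    (has_massZ (ramp n) mp)) => [t v|t]; first by rewrite kern_low.
  by rewrite !mulr1 subrK.
apply: has_mass_ext (has_massD (has_massZ (fun t => 1 - ramp (lev u) t) (mdirac u))
  (has_massZ (ramp (lev u)) (has_massZ (fun=> (size (Z u))%:R^-1) (has_mass_sum IH)))) => [t v|t].
  by rewrite kern_high.
rewrite big_const_seq count_predT iter_addr_0 mulVf ?mulr1 ?subrK //.
by rewrite gt_eqF ?size_gt0.
Qed.

Lemma kern_cont u v : continuous (fun t => kern u t v).
Proof.
elim/lev_ind: u => u nu => [|IH] t.
  rewrite (_ : (fun t => _) = fun t => (1 - ramp n t) * dirac u v + ramp n t * pt v); last first.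
    by apply/funext => s; rewrite kern_low.
  apply: cvgD; apply: cvgM; try exact: cvg_cst; last exact: ramp_continuous.
  by apply: cvgB; [exact: cvg_cst | exact: ramp_continuous].
rewrite (_ : (fun t => _) = fun t => (1 - ramp (lev u) t) * dirac u v +
    ramp (lev u) t * ((size (Z u))%:R^-1 * \sum_(z <- Z u) kern z t v)); last first.
  by apply/funext => s; rewrite kern_high.
apply: cvgD; apply: cvgM; try exact: cvg_cst; try exact: ramp_continuous.
  by apply: cvgB; [exact: cvg_cst | exact: ramp_continuous].
apply: cvgM; first exact: cvg_cst.
elim: (Z u) IH => [|z l IHl] IH.
  rewrite big_nil (_ : (fun t => _) = fun=> 0); first exact: cvg_cst.
  by apply/funext => s; rewrite big_nil.
rewrite big_cons (_ : (fun t => _) = fun t => kern z t v + \sum_(z <- l) kern z t v).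
  by apply: cvgD; [apply: IH; left | apply: IHl => z' ?; apply: IH; right].
by apply/funext => s; rewrite big_cons.
Qed.

Let sum_neq0 (l : list V) (f : V -> R) : \sum_(z <- l) f z <> 0 ->
  exists2 z, List.In z l & f z <> 0.
Proof.
elim: l => [|z l IH]; rewrite ?big_nil // big_cons => ne.
case: (pselect (f z = 0)) => [f0|]; last by exists z => //; left.
by have [z' ? ?] := IH (fun e => ne (etrans (congr2 +%R f0 e) (addr0 _))); exists z' => //; right.
Qed.

Let rmp u (t : R) := ramp (maxn (lev u) n) t.

(** Mass started at [u] is still there, has entered the apex, or has passed on to a dominating
    vertex. *)
Lemma kern_cases u t v : kern u t v <> 0 ->
  [\/ v = u /\ rmp u t <> 1, ramp n t <> 0 /\ pt v <> 0 |
      [/\ (n < lev u)%N, rmp u t <> 0 & exists2 z, List.In z (Z u) & kern z t v <> 0]].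
Proof.
have split2 (a b x y : R) : a * x + b * y <> 0 -> (a <> 0 /\ x <> 0) \/ (b <> 0 /\ y <> 0).
  move=> ne; case: (pselect (a = 0)) => [a0|a0].
    by right; split=> e; apply: ne; rewrite a0 e ?mul0r ?mulr0 addr0.
  case: (pselect (x = 0)) => [x0|x0]; last by left.
  by right; split=> e; apply: ne; rewrite x0 e ?mul0r ?mulr0 addr0.
have dir w : dirac u w <> 0 -> w = u by rewrite /dirac; case: asboolP.
have ne1 (r : R) : 1 - r <> 0 -> r <> 1 by move=> ne e; apply: ne; rewrite e subrr.
case: (ltnP n (lev u)) => nu.
  have rE : rmp u t = ramp (lev u) t by rewrite /rmp; congr ramp; lia.
  rewrite kern_high // => /split2 [[/ne1 r1 /dir ->]|[r0 sz]].
    by constructor 1; rewrite rE.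
  constructor 3; rewrite rE; split=> //; apply: sum_neq0 => e; apply: sz.
  by rewrite e mulr0.
have rE : rmp u t = ramp n t by rewrite /rmp; congr ramp; lia.
rewrite kern_low // => /split2 [[/ne1 r1 /dir ->]|[r0 sz]]; first by constructor 1; rewrite rE.
by constructor 2.
Qed.

(** Once the ramp of level [n] has started, those of all higher levels are complete and no mass
    remains there. *)
Lemma kern_base u t v : ramp n t <> 0 -> kern u t v <> 0 -> (lev v <= n)%N.
Proof.
move=> rn; elim/lev_ind: u => u nu => [|IH] /kern_cases [[-> r1]|[_ /p_lev //]|[nu' _ [z zZ kz]]] //.
- by move: nu'; lia.
- rewrite leqNgt; apply/negP => nu'; apply: rn.
  by apply: (@ramp_order _ (maxn (lev u) n)) r1; lia.
- exact: IH kz.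
Qed.

Let nearC u v : near u v -> near v u.
Proof. by case=> [->|/adjC]; [left | right]. Qed.

(** Induction on the sum of levels, replacing the vertex of higher level by a dominating one, which
    keeps the pair near. The lower one never moves first: its ramp starts only after the higher one
    is complete. Mass in the apex is covered by [kern_base] and [p_near]. *)
Lemma kern_clique u u' v v' t : near u u' -> kern u t v <> 0 -> kern u' t v' <> 0 -> near v v'.
Proof.
have [m] := ubnP (lev u + lev u'); elim: m u u' => // m IH u u' um uu kv kv'.
have base x y : ramp n t <> 0 -> kern u t x <> 0 \/ kern u' t x <> 0 -> pt y <> 0 -> near x y.
  by move=> rn kx py; apply: p_near => //; case: kx => /(kern_base rn).
have ord w w' : (n < lev w')%N -> (lev w' < lev w)%N -> rmp w t <> 1 -> rmp w' t <> 0 -> False.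
  by move=> n1 n2 r1 r0; apply: r0; apply: (ramp_order _ r1); lia.
case: (kern_cases kv) => [[ev r1]|[rn py]|[nu r0 [z zZ kz]]].
- case: (kern_cases kv') => [[ev' r1']|[rn py]|[nu' r0' [z' zZ' kz']]].
  + by rewrite ev ev'.
  + by apply: base => //; left.
  + case: (leqP (lev u) (lev u')) => le; last by case: (ord u u').
    apply: (IH u z') => //; first by have := Z_lev nu' zZ'; lia.
    by apply/nearC/(Z_dom nu' zZ') => //; apply: nearC.
- by apply/nearC; apply: base => //; right.
- case: (leqP (lev u') (lev u)) => le.
    apply: (IH z u') => //; first by have := Z_lev nu zZ; lia.
    exact: (Z_dom nu zZ).
  case: (kern_cases kv') => [[ev' r1']|[rn py]|[nu' r0' [z' zZ' kz']]].
  + by case: (ord u' u).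
  + by apply: base => //; left.
  + apply: (IH u z') => //; first by have := Z_lev nu' zZ'; lia.
    by apply/nearC/(Z_dom nu' zZ'); [apply: nearC | lia].
Qed.

Lemma kern0 u v : kern u 0 v = dirac u v.
Proof.
by case: (ltnP n (lev u)) => nu; [rewrite kern_high | rewrite kern_low] => //;
  rewrite ramp0 subr0 mul1r mul0r addr0.
Qed.

Lemma kern1 u v : kern u 1 v = pt v.
Proof.
elim/lev_ind: u => u nu => [|IH].
  by rewrite kern_low // ramp1 subrr mul0r add0r mul1r.
rewrite kern_high // ramp1 subrr mul0r add0r mul1r.
rewrite (eq_big_In (g := fun=> pt v)) //.
rewrite big_const_seq count_predT iter_addr_0 -[X in _ * X]mulr_natl mulKf //.
by rewrite gt_eqF ?size_gt0.
Qed.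

Lemma kern_equiv (a b : V -> V) : cancel a b -> cancel b a ->
  (forall u, lev (a u) = lev u) -> (forall v, pt (a v) = pt v) ->
  (forall u z, (n < lev u)%N -> List.In (a z) (Z (a u)) <-> List.In z (Z u)) ->
  forall u t v, kern (a u) t (a v) = kern u t v.
Proof.
move=> aK bK alev ap aZ u t v.
have da w : dirac (a w) (a v) = dirac w v.
  rewrite /dirac; congr (nat_of_bool _)%:R; apply/asboolP/asboolP => [/(can_inj aK)|->] //.
elim/lev_ind: u => u nu => [|IH]; first by rewrite !kern_low ?alev // da ap.
have pe : perm_eq (Z (a u) : seq {classic V}) (map a (Z u)).
  apply: NoDup_perm; first by apply: Z_nodup; rewrite alev.
    by apply: NoDup_map (can_inj aK) _; apply: Z_nodup.
  move=> z; rewrite List.in_map_iff; split=> [zZ|[z' [<- /aZ]]]; last by apply.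
  by exists (b z); split; rewrite ?bK //; apply/aZ; rewrite ?bK.
rewrite !kern_high ?alev // da.
have -> : size (Z (a u)) = size (Z u) by rewrite (perm_size pe) size_map.
congr (_ + _ * (_ * _)).
rewrite (perm_big (I := {classic V}) _ pe) /= big_map.
exact: eq_big_In.
Qed.

(** The pushed mass runs from the identity at time 0 to the constant [p] at time 1. Invariance of
    [A] is asked of any point with the pushed coordinates, so that the homotopy itself stays
    hidden. *)
Lemma dismantle_contractible (A : set T) : A p ->
  (forall x t, A x -> forall y : T,
     (forall v, proj1_sig y v = \sum_(u <- supp x) proj1_sig x u * kern u t v) -> A y) ->
  contractible R A.
Proof.
move=> Ap AF.
have [L LP] := choice kern_mass.
have Lnd u : List.NoDup (L u) by case: (LP u).
have Ls u t v : kern u t v <> 0 -> List.In v (L u) by case: (LP u) => _ + _; apply.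
have L1 u t : \sum_(v <- L u) kern u t v = 1 by case: (LP u).
pose F := kflow kern_ge0 Lnd Ls L1 kern_clique.
have pt_eq (x y : T) : (forall v, proj1_sig x v = proj1_sig y v) -> x = y.
  case: x y => [x px] [y py] /= /funext e; subst y.
  by congr exist; apply: Prop_irrelevance.
exists p; split=> //; exists F; split.
  by apply: continuous_subspaceT; apply: kflow_continuous; apply: kern_cont.
split=> [x t Ax _|x Ax]; first exact: (AF x t Ax).
have [nd _ s s1] := suppP x.
split; apply: pt_eq => v /=; rewrite /push.
  rewrite (eq_bigr (fun u => proj1_sig x u * dirac u v)) => [|u _]; last by rewrite kern0.
  have ndv : List.NoDup [:: v] by constructor=> //; constructor.
  rewrite (@sum_supp _ _ (fun u => proj1_sig x u * dirac u v) (supp x) [:: v] nd ndv) => [|u ne|u ne].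
  - by rewrite big_seq1 /dirac asboolT ?mulr1.
  - by apply: s => e; apply: ne; rewrite e mul0r.
  - by left; apply: contrapT => e; apply: ne; rewrite /dirac asboolF ?mulr0 // => e'; apply: e.
rewrite (eq_bigr (fun u => proj1_sig x u * pt v)) => [|u _]; last by rewrite kern1.
by rewrite -mulr_suml s1 mul1r.
Qed.

(** Reindex the sum by the automorphism; the kernel commutes with it because level, apex and the
    sets [Z] do. *)
Lemma kern_push_equiv (a b : V -> V) (x y : T) t : cancel a b -> cancel b a ->
  (forall u, lev (a u) = lev u) -> (forall v, pt (a v) = pt v) ->
  (forall u z, (n < lev u)%N -> List.In (a z) (Z (a u)) <-> List.In z (Z u)) ->
  (forall v, proj1_sig x (a v) = proj1_sig x v) ->
  (forall v, proj1_sig y v = \sum_(u <- supp x) proj1_sig x u * kern u t v) ->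
  forall v, proj1_sig y (a v) = proj1_sig y v.
Proof.
move=> aK bK alev ap aZ ax yE v; rewrite !yE.
have [nd _ s _] := suppP x.
rewrite (@sum_supp _ _ (fun u => proj1_sig x u * kern u t v) (supp x) (map b (supp x))) //.
- rewrite big_map; apply: eq_bigr => u _.
  by rewrite -[in LHS](bK u) ax (kern_equiv aK bK alev ap aZ).
- exact: NoDup_map (can_inj bK) nd.
- by move=> u ne; apply: s => e; apply: ne; rewrite e mul0r.
- move=> u ne; apply/List.in_map_iff; exists (a u); rewrite aK; split=> //.
  by apply: s; rewrite ax => e; apply: ne; rewrite e mul0r.
Qed.

End Dismantle.

(** * Fixed-point sets *)

Lemma bigmax_In (I : Type) (l : list I) (F : I -> nat) i :
  List.In i l -> F i <= \max_(j <- l) F j.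
Proof.
elim: l => //= j l IH [->|/IH h]; rewrite big_cons leq_max ?leqnn //.
by rewrite h orbT.
Qed.

Lemma bigmax_attained (I : Type) (l : list I) (F : I -> nat) n :
  n < \max_(j <- l) F j -> exists2 i, List.In i l & \max_(j <- l) F j = F i.
Proof.
elim: l => [|j l IH]; rewrite ?big_nil // big_cons => nm.
case: (leqP (\max_(j <- l) F j) (F j)) => le; first by exists j; [left | lia].
have [|i il e] := IH; first by lia.
by exists i; [right | lia].
Qed.

Lemma bigmax_le (I : Type) (l : list I) (F : I -> nat) m :
  (forall i, List.In i l -> F i <= m) -> \max_(j <- l) F j <= m.
Proof.
elim: l => [|j l IH] h; rewrite ?big_nil // big_cons geq_max h; last by left.
by apply: IH => i il; apply: h; right.
Qed.

Section Rips.
Local Open Scope nat_scope.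
Variables (G : groupType) (Lam : finType) (P : Lam -> set G) (S : list G).
Hypothesis subP : forall lam, is_subgroup (P lam).
Hypothesis gen : generates S.
Local Notation X := (vertex P).
Local Notation sd := (@sdist G Lam P S).

Lemma rips_near n (u v : X) : (u = v \/ rips S n u v) <-> sd u v <= n.
Proof.
split=> [[->|[_ /(sdist_leP subP gen)]]|le] //; first by rewrite sdistxx.
by case: (pselect (u = v)) => ne; [left | right; split=> //; apply/(sdist_leP subP gen)].
Qed.

Lemma ripsC n (u v : X) : rips S n u v -> rips S n v u.
Proof.
move=> [ne /(sdist_leP subP gen) le]; split; first exact: nesym.
by apply/(sdist_leP subP gen); rewrite sdistC.
Qed.

(** For each target of [o] the transporting elements form, if any exist, a coset of the finite
    stabiliser of [r] and [o]. *)
Lemma transporter_finite (r u o : X) (O : list X) :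
  (exists l : list G, forall h, act h r = r -> act h o = o -> List.In h l) ->
  exists l : list G, forall h, act h r = u -> List.In (act h o) O -> List.In h l.
Proof.
move=> [ls lsP]; elim: O => [|o' O [l lP]]; first by exists [::].
case: (pselect (exists h, act h r = u /\ act h o = o')) => [[h1 [h1r h1o]]|no]; last first.
  exists l => h hr /= [e|]; last exact: lP.
  by case: no; exists h.
exists ([seq (h1 * s)%g | s <- ls] ++ l) => h hr /= [e|hO]; apply/List.in_or_app; last first.
  by right; apply: lP.
left; apply/List.in_map_iff; exists (h1^-1 * h)%g; split; first by rewrite mulgA mulgV mul1g.
by apply: lsP; rewrite actM; [rewrite hr -h1r actK | rewrite -e -h1o actK].
Qed.

Section FixedSet.
Variables (R : realType) (n : nat) (H : set G).
Hypothesis subH : is_subgroup H.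
Hypothesis stab2 : forall u v : X, u <> v ->
  exists l : list G, forall h, act h u = u -> act h v = v -> List.In h l.
Hypothesis dom : forall o v : X, n < sd o v -> exists z : X,
  (forall u, sd u v <= n -> sd u o <= sd o v -> sd u z <= n) /\
  (forall u, sd u o <= n -> sd u v <= sd o v -> sd u z < sd o v).

(** As [H] fixes [p], it permutes the support [B]; the level is therefore [H]-invariant, and an
    equivariant choice of the sets [Z] makes the deformation commute with [H]. *)
Lemma fixed_set_contractible (p : realization R (@rips G Lam P S n)) :
  @fixed_set G Lam P S R n H p -> contractible R (@fixed_set G Lam P S R n H).
Proof.
move=> fp; have [H1 [HM HV]] := subH.
have [ndp clp sp s1] := suppP p.
have [B [_ OP]] := finite_list sp.
have OH h o : H h -> List.In o B -> List.In (act h o) B.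
  by move=> Hh /OP po; apply/OP; rewrite fp.
have Oclique o o' : List.In o B -> List.In o' B -> sd o o' <= n.
  move=> /OP/sp oi /OP/sp oi'; apply/rips_near.
  by case: (pselect (o = o')) => ne; [left | right; apply: clp].
pose lev u := \max_(o <- B) sd o u.
have levH h u : H h -> lev (act h u) = lev u.
  have le h' w : H h' -> lev (act h' w) <= lev w.
    move=> Hh; apply: bigmax_le => o oO.
    rewrite -(actVK h' o) (sdist_act subP gen).
    by apply: (bigmax_In (fun o => sd o w)); apply: OH => //; apply: HV.
  move=> Hh; apply/eqP; rewrite eqn_leq le //=.
  by rewrite -{1}[u](actK h) le //; apply: HV.
have [b0 b0O] : exists o, List.In o B.
  apply: contrapT => no; have : (\sum_(v <- supp p) proj1_sig p v = 0)%R.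
    rewrite (eq_big_In (g := fun=> 0%R)) ?big1 // => v _.
    by apply: contrapT => ne; apply: no; exists v; apply/OP.
  by rewrite s1 => /eqP; rewrite oner_eq0.
(* Domination is applied at the vertex of [B] farthest from [u]; as [B] has diameter at most [n], it
   also bounds the distance of [z] to the rest of [B]. *)
have domZ u : exists z, n < lev u -> lev z < lev u /\
    forall u', sd u u' <= n -> lev u' <= lev u -> sd z u' <= n.
  case: (ltnP n (lev u)) => nu; last by exists u.
  have [b oO e] := bigmax_attained nu; rewrite -/(lev u) in e.
  have [|z [z1 z2]] := dom (o := b) (v := u); first by rewrite -e.
  exists z => _; split.
    rewrite [X in _ < X]e; apply: leq_ltn_trans (_ : (sd b u).-1 < _); last by lia.
    apply: bigmax_le => o' o'B.
    have := z2 o' (Oclique _ _ o'B oO); rewrite -e.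
    by move=> /(_ (bigmax_In (fun o => sd o u) o'B)); lia.
  move=> u' uu' lu'; rewrite sdistC //; apply: z1; first by rewrite sdistC.
  rewrite -e sdistC //; apply: leq_trans lu'; exact: (bigmax_In (fun o => sd o u') oO).
have [zf zfP] := choice domZ.
(* orbit representatives make the choice of dominating vertices equivariant *)
pose orb u : set X := [set v | exists2 h, H h & v = act h u]%classic.
have [rp rpP] : exists rp : set X -> X, forall A u, A u -> A (rp A).
  have ex (A : set X) : exists x, forall u, A u -> A x.
    by case: (pselect (exists x, A x)) => [[x Ax]|no]; [exists x | exists b0 => u Au; case: no; exists u].
  by have [f fP] := choice ex; exists f => A u; apply: fP.
pose rep u := rp (orb u).
have repH h u : H h -> rep (act h u) = rep u.
  move=> Hh; congr rp; apply/seteqP; split=> v /= [k Hk ->].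
    by exists (k * h)%g; [apply: HM | rewrite actM].
  by exists (k * h^-1)%g; [apply: HM => //; apply: HV | rewrite actM actK].
have repP u : exists2 h, H h & act h (rep u) = u.
  have [|h Hh e] := rpP (orb u) u; first by exists 1%g => //; rewrite act1.
  by exists h^-1%g; [apply: HV | rewrite /rep e actK].
have levrep u : lev (rep u) = lev u.
  by have [h Hh e] := repP u; rewrite -[in RHS]e levH.
(* All elements of [H] carrying [rep u] to [u] are used at once, so no choice among them breaks
   equivariance. *)
pose Zset u v := exists h, [/\ H h, act h (rep u) = u & v = act h (zf (rep u))].
have exZ u : exists l : list X, n < lev u ->
    List.NoDup l /\ forall v, List.In v l <-> Zset u v.
  case: (ltnP n (lev u)) => nu; last by exists [::].
  (* Such elements also map [b0] into the finite set [B]; as [rep u] and [b0] are distinct, having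
     levels above and not above [n], there are finitely many of them. *)
  have ne : rep u <> b0.
    move=> e; suff : lev (rep u) <= n by rewrite levrep; lia.
    by rewrite e; apply: bigmax_le => o oO; apply: Oclique.
  have [l lP] := transporter_finite u B (stab2 ne).
  have [|l' [nd l'P]] := @finite_list X (Zset u) [seq act h (zf (rep u)) | h <- l].
    move=> v [h [Hh hr ->]]; apply/List.in_map_iff; exists h; split=> //.
    by apply: lP => //; apply: OH.
  by exists l'.
have [Z ZP] := choice exZ.
have Z_nodup u : n < lev u -> List.NoDup (Z u) by case/ZP.
have ZE u v : n < lev u -> List.In v (Z u) <-> Zset u v by case/ZP.
have Z_nil u : n < lev u -> Z u <> [::].
  move=> nu e; have [h Hh hr] := repP u.
  have : List.In (act h (zf (rep u))) (Z u) by apply/(ZE u) => //; exists h.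
  by rewrite e.
have Z_lev u z : n < lev u -> List.In z (Z u) -> lev z < lev u.
  move=> nu /(ZE u _ nu) [h [Hh hr ->]]; rewrite levH // -(levrep u).
  by have /zfP [] : n < lev (rep u) by rewrite levrep.
have Z_dom u z u' : n < lev u -> List.In z (Z u) -> u = u' \/ rips S n u u' ->
    lev u' <= lev u -> z = u' \/ rips S n z u'.
  move=> nu /(ZE u _ nu) [h [Hh hr ->]] /rips_near uu' lu'; apply/rips_near.
  rewrite -[u'](actVK h) (sdist_act subP gen).
  have /zfP [_ zd] : n < lev (rep u) by rewrite levrep.
  apply: zd; last by rewrite levH ?levrep //; apply: HV.
  by rewrite -[rep u](actK h) hr (sdist_act subP gen).
apply: (@dismantle_contractible R X (rips S n) (@ripsC n) n lev p Z) => //.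
- by move=> v /OP vO; apply: bigmax_le => o oO; apply: Oclique.
- move=> u v lu /OP vO; apply/rips_near; rewrite sdistC //.
  exact: leq_trans (bigmax_In (fun o => sd o u) vO) lu.
move=> x t fx y yE h Hh v.
apply: (@kern_push_equiv R X (rips S n) n lev p Z Z_nodup Z_lev
  (act h) (act h^-1%g) x y t) => //.
- exact: actK.
- exact: actVK.
- by move=> u; apply: levH.
- exact: fp.
- move=> u z nu; rewrite !ZE ?levH // /Zset repH //; split=> -[k [Hk kr kz]].
    exists (h^-1 * k)%g; split; [by apply: HM => //; apply: HV | |].
      by rewrite actM kr actK.
    by rewrite actM -kz actK.
  exists (h * k)%g; split; [exact: HM | by rewrite actM kr | by rewrite actM -kz].
- exact: fx.
Qed.

End FixedSet.
End Rips.

Theorem theorem2p6 (G : groupType) (Lam : finType) (P : Lam -> set G)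
    (S : list G) :
  rel_hyperbolic P S ->
  exists N : nat, forall n : nat, (N <= n)%N ->
    forall H : set G, is_subgroup H ->
      @fixed_set G Lam P S Rdefinitions.R n H = set0 \/
      contractible Rdefinitions.R (@fixed_set G Lam P S Rdefinitions.R n H).
Proof.
move=> [subP [gen [finX [connX [delta thinX]]]]].
have conn (u v : vertex P) : exists k, reach (coned_off S) u v k.
  by have [p [wp lp]] := connX u v; exists (List.length p), p.
have thin' := thin_triangles_thin (@coned_offC G Lam P S) conn thinX.
have [D HD] := sthin subP gen finX conn thin'.
have [N HN] := rips_domination subP gen conn HD.
(* [N] is fixed before [H], and any point fixed by [H] serves as apex. *)
exists N => n Nn H subH.
have [e|/set0P [p fp]] := eqVneq (@fixed_set G Lam P S Rdefinitions.R n H) set0; first by left.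
right; apply: (fixed_set_contractible subP gen subH _ _ fp).
- exact: (stab2_finite subP gen finX conn).
- exact: HN.
Qed.
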